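(* Let $L>0$ and let $u\in H^1_0(0,L)$, $u\ne0$. Then $$\|u\|_\infty^2\le\|u\|\,\|u'\|\left(1-2e^{-\frac{L\|u'\|}{\|u\|}}\right).$$ The coefficients of the two terms on the right-hand side are sharp and no extremal functions exist.
   Context: $\|\cdot\|$ is the $L_2(0,L)$-norm and $\|\cdot\|_\infty$ the $L_\infty(0,L)$-norm. The two terms on the right-hand side are $\|u\|\|u'\|$ with coefficient $1$ and $\|u\|\|u'\|e^{-L\|u'\|/\|u\|}$ with coefficient $-2$. Sharpness means: the coefficient $1$ cannot be decreased, whatever the coefficient of the second term; and, with the coefficient $1$, the number $2$ cannot be replaced by a larger one. An extremal function is a non-zero $u\in H^1_0(0,L)$ for which equality holds. *)

(* Defs.v *)
From HB Require Import structures.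
From mathcomp Require Import all_boot all_order all_algebra.
From mathcomp Require Import all_classical all_reals all_analysis.
Import Order.TTheory GRing.Theory Num.Theory numFieldNormedType.Exports.

Set Implicit Arguments.
Unset Strict Implicit.
Unset Printing Implicit Defensive.

Local Open Scope classical_set_scope.
Local Open Scope ring_scope.

(** A function on the interval (0, L) is represented by a total [u : R -> R];
    only its restriction to ]0, L[ matters.  [u \_ `]0, L[] is its extension by
    [point : R], which is 0. *)

Definition in_L2 (R : realType) (L : R) (u : R -> R) : Prop :=
  (u \_ `]0, L[) \in Lfun (@lebesgue_measure R) 2%:E.

(** [fine] only strips a finite value when [in_L2 L u]. *)
Definition norm2 (R : realType) (L : R) (u : R -> R) : R :=
  fine ('N[@lebesgue_measure R]_2%:E [EFin \o (u \_ `]0, L[)%R])%E.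

(** Essential supremum of |u| over ]0, L[: the extension by 0 to R does not
    change it since |u| >= 0.  It is kept in [\bar R], hence an upper bound on
    it includes the fact that it is finite. *)
Definition norm_oo (R : realType) (L : R) (u : R -> R) : \bar R :=
  ('N[@lebesgue_measure R]_+oo [EFin \o (u \_ `]0, L[)%R])%E.

Definition nonzero (R : realType) (L : R) (u : R -> R) : Prop :=
  ~ (\forall x \ae (@lebesgue_measure R), x \in `]0, L[ -> u x = 0).

Definition test_function (R : realType) (L : R) (phi : R -> R) : Prop :=
  [/\ forall (n : nat) (x : R), derivable (phi^`(n)%classic) x 1,
      compact (closure [set x | phi x != 0]) &
      closure [set x | phi x != 0] `<=` `]0, L[].

Definition weak_derivative (R : realType) (L : R) (u du : R -> R) : Prop :=
  forall phi : R -> R, test_function L phi ->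
    \int[@lebesgue_measure R]_(x in `]0, L[) (u x * phi^`()%classic x) =
    - \int[@lebesgue_measure R]_(x in `]0, L[) (du x * phi x).

(** [in_H10 L u du]: u belongs to H^1_0(0, L), the closure of C_c^oo(0, L)
    (the [test_function]s) in H^1(0, L), and u' = du.  Weak derivatives are unique up to null sets, so
    the L^2-norm of du depends on u only.  The weak derivative of u - phi
    being du - phi', the square root below is the H^1-norm of u - phi. *)
Definition in_H10 (R : realType) (L : R) (u du : R -> R) : Prop :=
  [/\ in_L2 L u, in_L2 L du, weak_derivative L u du &
      forall e : R, 0 < e -> exists2 phi : R -> R, test_function L phi &
        Num.sqrt (norm2 L (u \- phi) ^+ 2 +
                  norm2 L (du \- phi^`()%classic) ^+ 2) < e].

(* Main.v *)
Require Import Defs.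
From HB Require Import structures.
From mathcomp Require Import all_boot all_order all_algebra.
From mathcomp Require Import all_classical all_reals all_analysis.
From mathcomp Require Import measurable_realfun ess_sup_inf ring lra.
Import Order.TTheory GRing.Theory Num.Theory numFieldNormedType.Exports.

Set Implicit Arguments.
Unset Strict Implicit.
Unset Printing Implicit Defensive.

Local Open Scope classical_set_scope.
Local Open Scope ring_scope.

(** Two facts carry the proof.  First, for every l > 0 the energy
    E_l(u) = |u'|^2 + l^2 |u|^2 (L^2-norms on the interval) controls the sup:
    the Green function of - d^2/dx^2 + l^2 with Dirichlet conditions is at most
    tanh (l L / 2) / (2 l), its value at the midpoint, so that
      |u|_oo^2 <= tanh (l L / 2) / (2 l) * E_l(u).
    This is proved for test functions ([test_function_sup]) by integrating
      0 <= (u' - c C)^2 + (l u - c S)^2,   C = cosh, S = sinh,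
    in which the cross terms form an exact derivative, on each side of a given
    point; it passes to the closure because an L^2-limit of functions that are
    uniformly bounded by M is bounded by M almost everywhere.

    With t = L |u'| / |u| and s = l L the estimate reads
      |u|_oo^2 / (|u| |u'|) <= tanh (s / 2) (t / s + s / t) / 2.
    The natural choice s = t gives tanh (t / 2), which exceeds 1 - 2 e^-t by
    about 2 e^-2t.  Second, then: the minimum over s is not at t.  Shifting
    to s = t - 2 e^-t lowers tanh (s / 2) by about 4 e^-2t and raises
    (t / s + s / t) / 2 by only about 2 e^-2t / t^2, which is enough
    ([strict_ineq_scalar]) as soon as t (t - 2 e^-t) > 1 + e^-t.  This holds
    when t^2 >= 3, and t^2 >= 3 for every u: it follows from the same energy
    estimate at l = 1 / L together with |u|^2 <= L |u|_oo^2.  The resulting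
    inequality is strict, so that there is no extremal function.

    For the sharpness, equality in the energy estimate holds for
    sinh (l min (x, L - x)).  As s = l L grows, this function satisfies
    |u|_oo^2 = |u| |u'| (1 - (2 + o(1)) e^-t), which excludes any larger
    constant than 2 and, since t tends to infinity, any smaller constant
    than 1 ([near_extremal]).  A test function is obtained by smoothing the
    tent min (x, L - x) with the help of y e^(-1/y), which is smooth when
    extended by 0, has slope in [0, 1] and differs from the positive part of y
    by at most 1.  Because the slope stays in [0, 1], the norms of the smoothed
    function and of its derivative are bounded above by those of the exact
    profile, and only the lower bounds cost an error. *)

(** * Infinitely differentiable functions *)

Lemma is_derive_fcomp {R : realType} (f g : R -> R) (x df dg : R) :
  is_derive (g x) (1 : R) f df -> is_derive x (1 : R) g dg ->
  is_derive x (1 : R) (fun y => f (g y)) (df * dg).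
Proof. by move=> ? ?; exact: is_derive1_comp. Qed.

Lemma is_derive_fmul {R : realType} (f g : R -> R) (x df dg : R) :
  is_derive x (1 : R) f df -> is_derive x (1 : R) g dg ->
  is_derive x (1 : R) (fun y => f y * g y) (f x * dg + g x * df).
Proof. by move=> fdf gdg; have := @is_deriveM _ _ f g x 1 _ _ fdf gdg. Qed.

Lemma is_derive_fadd {R : realType} (f g : R -> R) (x df dg : R) :
  is_derive x (1 : R) f df -> is_derive x (1 : R) g dg ->
  is_derive x (1 : R) (fun y => f y + g y) (df + dg).
Proof. by move=> fdf gdg; have := @is_deriveD _ _ _ f g x 1 _ _ fdf gdg. Qed.

Lemma is_derive_affine {R : realType} (l a x : R) :
  is_derive x (1 : R) (fun y => l * (y - a)) l.
Proof.
have D := is_derive_fmul (is_derive_cst l x 1)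
  (is_derive_fadd (is_derive_id x 1) (is_derive_cst (- a) x 1)).
by apply: is_derive_eq D _; rewrite /=; ring.
Qed.

Lemma is_derive_continuous {R : realType} (f df : R -> R) :
  (forall x, is_derive x (1 : R) f (df x)) -> continuous f.
Proof.
move=> fdf x; apply: differentiable_continuous; apply/derivable1_diffP.
exact: (@ex_derive _ _ _ _ _ _ _ (fdf x)).
Qed.

Lemma continuous_sqr {R : realType} (f : R -> R) :
  continuous f -> continuous (fun x => f x ^+ 2).
Proof.
move=> cf x; apply: (@continuous_comp _ _ _ f (fun y => y ^+ 2)); first exact: cf.
exact: exprn_continuous.
Qed.

(** [smooth n f]: f is n times differentiable.  Recursion on a derivative given
    as a relation, rather than on iterated derivatives, makes closure under
    products and composition a plain induction on n. *)
Fixpoint smooth {R : realType} (n : nat) (f : R -> R) : Prop :=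
  if n is n'.+1 then
    exists2 df : R -> R, (forall x : R, is_derive x (1 : R) f (df x)) & smooth n' df
  else True.

Lemma smooth_pred {R : realType} n (f : R -> R) : smooth n.+1 f -> smooth n f.
Proof.
elim: n f => [//|n IH] f [df fdf sdf].
by exists df => //; exact: IH.
Qed.

Lemma smooth_cst {R : realType} n (c : R) : smooth n (fun=> c).
Proof. by elim: n c => [//|n IH] c; exists (fun=> 0) => // x; exact: is_derive_cst. Qed.

Lemma smooth_id {R : realType} n : smooth n (fun x : R => x).
Proof.
case: n => [//|n]; exists (fun=> 1); last exact: smooth_cst.
by move=> x; exact: is_derive_id.
Qed.

Lemma smoothD {R : realType} n (f g : R -> R) :
  smooth n f -> smooth n g -> smooth n (fun x => f x + g x).
Proof.
elim: n f g => [//|n IH] f g [df fdf sdf] [dg gdg sdg].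
exists (fun x => df x + dg x); last exact: IH.
by move=> x; exact: is_deriveD.
Qed.

Lemma smoothM {R : realType} n (f g : R -> R) :
  smooth n f -> smooth n g -> smooth n (fun x => f x * g x).
Proof.
elim: n f g => [//|n IH] f g sf sg.
have sf' := smooth_pred sf; have sg' := smooth_pred sg.
case: sf sg => [df fdf sdf] [dg gdg sdg].
exists (fun x => f x * dg x + g x * df x).
  by move=> x; have := @is_deriveM _ _ f g x 1 _ _ (fdf x) (gdg x).
by apply: smoothD; exact: IH.
Qed.

(** By induction on n, with f' and g in place of f and g. *)
Lemma smooth_comp {R : realType} n (f g : R -> R) :
  smooth n f -> smooth n g -> smooth n (fun x => f (g x)).
Proof.
elim: n f g => [//|n IH] f g [df fdf sdf] sg.
have sg' := smooth_pred sg.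
case: sg => [dg gdg sdg].
exists (fun x => df (g x) * dg x).
  by move=> x; exact: is_derive1_comp.
by apply: smoothM => //; exact: IH.
Qed.

Lemma smoothN {R : realType} n (f : R -> R) :
  smooth n f -> smooth n (fun x => - f x).
Proof.
move=> sf; rewrite (_ : (fun x => _) = (fun x => (- 1) * f x)); last first.
  by apply/funext => x; rewrite mulN1r.
by apply: smoothM => //; exact: smooth_cst.
Qed.

Lemma smooth_sqr {R : realType} n (f : R -> R) :
  smooth n f -> smooth n (fun x => f x ^+ 2).
Proof. by move=> sf; exact: smoothM. Qed.

Lemma derivable_smooth {R : realType} (f : R -> R) :
  (forall n x, derivable (f^`(n)%classic) x 1) -> forall n, smooth n f.
Proof.
move=> df n; elim: n f df => [//|n IH] f df.
exists f^`()%classic.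
  by move=> x; rewrite derive1E; apply/derivableP; exact: (df 0).
by apply: IH => k x; rewrite -derive1Sn.
Qed.

Lemma smooth_derivable {R : realType} (f : R -> R) :
  (forall n, smooth n f) -> forall n x, derivable (f^`(n)%classic) x 1.
Proof.
have H n g : smooth n.+1 g -> forall x, derivable (g^`(n)%classic) x 1.
  elim: n g => [|n IH] g [dg gdg sdg] x; first exact: ex_derive.
  rewrite derive1Sn (_ : g^`()%classic = dg); first exact: IH.
  by apply/funext => y; rewrite derive1E derive_val.
by move=> sf n; exact/H/sf.
Qed.

Lemma smooth_continuous {R : realType} (f : R -> R) : smooth 1 f -> continuous f.
Proof. by move=> [df fdf _]; exact: is_derive_continuous fdf. Qed.

Lemma smooth_affine {R : realType} n (l a : R) : smooth n (fun y => l * (y - a)).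
Proof.
apply: smoothM; first exact: smooth_cst.
by apply: smoothD; [exact: smooth_id|exact: smooth_cst].
Qed.

(** * Hyperbolic functions *)

Definition cosh {R : realType} (x : R) : R := (expR x + expR (- x)) / 2.
Definition sinh {R : realType} (x : R) : R := (expR x - expR (- x)) / 2.

Section hyperbolic.
Context {R : realType}.
Implicit Types a b x : R.

Lemma is_derive_expRN x : is_derive x (1 : R) (fun y => expR (- y)) (- expR (- x)).
Proof.
have dN : is_derive x (1 : R) (fun y : R => - y) (- 1).
  exact: (@is_deriveN _ _ _ id x 1 1 (is_derive_id _ _)).
rewrite -[X in is_derive _ _ _ X]mulrN1.
exact: is_derive_fcomp (is_derive_expR _) dN.
Qed.

Lemma is_derive_cosh x : is_derive x (1 : R) cosh (sinh x).
Proof.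
have D := is_derive_fmul (is_derive_fadd (is_derive_expR x) (is_derive_expRN x))
  (is_derive_cst (2^-1 : R) x 1).
rewrite (_ : sinh x = (expR x + expR (- x)) * 0 + 2^-1 * (expR x + - expR (- x))).
  exact: D.
by rewrite /sinh; ring.
Qed.

Lemma is_derive_sinh x : is_derive x (1 : R) sinh (cosh x).
Proof.
have dN := @is_deriveN _ _ _ (fun y => expR (- y)) x 1 _ (is_derive_expRN x).
have D := is_derive_fmul (is_derive_fadd (is_derive_expR x) dN)
  (is_derive_cst (2^-1 : R) x 1).
rewrite (_ : cosh x = (expR x + - expR (- x)) * 0 + 2^-1 * (expR x + - - expR (- x))).
  exact: D.
by rewrite /cosh; ring.
Qed.

Lemma smooth_cosh_sinh n : smooth n (@cosh R) /\ smooth n (@sinh R).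
Proof.
elim: n => [//|n [IHc IHs]]; split.
  by exists sinh => //; exact: is_derive_cosh.
by exists cosh => //; exact: is_derive_sinh.
Qed.

Lemma smooth_cosh n : smooth n (@cosh R). Proof. by case: (smooth_cosh_sinh n). Qed.
Lemma smooth_sinh n : smooth n (@sinh R). Proof. by case: (smooth_cosh_sinh n). Qed.

Lemma sinh0 : sinh 0 = 0 :> R.
Proof. by rewrite /sinh oppr0 subrr mul0r. Qed.

Lemma sinhN x : sinh (- x) = - sinh x.
Proof. by rewrite /sinh opprK; lra. Qed.

Lemma coshN x : cosh (- x) = cosh x.
Proof. by rewrite /cosh opprK addrC. Qed.

Lemma sinh_gt0 x : 0 < x -> 0 < sinh x.
Proof. by move=> x0; rewrite /sinh divr_gt0// subr_gt0 ltr_expR; lra. Qed.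

Lemma cosh_gt0 x : 0 < cosh x.
Proof. by rewrite /cosh divr_gt0// addr_gt0// expR_gt0. Qed.

Lemma sqr_cosh x : cosh x ^+ 2 = sinh x ^+ 2 + 1.
Proof.
rewrite /cosh /sinh; have : expR x * expR (- x) = 1 by rewrite -expRD subrr expR0.
lra.
Qed.

Lemma sinh_le a b : a <= b -> sinh a <= sinh b.
Proof.
move=> ab; rewrite /sinh ler_pM2r ?invr_gt0// lerB// ler_expR//.
by rewrite lerN2.
Qed.

Lemma sinh_ge0 x : 0 <= x -> 0 <= sinh x.
Proof. by rewrite -[X in _ -> X <= _]sinh0; exact: sinh_le. Qed.

Lemma cosh_le a b : 0 <= a -> a <= b -> cosh a <= cosh b.
Proof.
move=> a0 ab; rewrite -ler_sqr ?nnegrE ?(ltW (cosh_gt0 _))// !sqr_cosh lerD2r.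
by rewrite ler_sqr ?nnegrE ?sinh_ge0 ?sinh_le// (le_trans a0).
Qed.

Lemma sinh_le_expR x : 0 <= x -> sinh x <= expR x.
Proof.
move=> x0; rewrite /sinh; have := expR_gt0 x; have := expR_gt0 (- x); lra.
Qed.

(** A linear lower bound for sinh below b, from 1 + x <= e^x alone. *)
Lemma sinh_lipschitz a b : 0 <= a -> a <= b ->
  sinh b - (b - a) * expR b <= sinh a.
Proof.
move=> a0 ab.
have h1 : expR b * (1 + (a - b)) <= expR a.
  rewrite [in leRHS](_ : a = b + (a - b)); last by ring.
  by rewrite expRD ler_pM2l ?expR_gt0// expR_ge1Dx.
have h2 : expR (- a) * (1 + (a - b)) <= expR (- b).
  rewrite [in leRHS](_ : - b = - a + (a - b)); last by ring.
  by rewrite expRD ler_pM2l ?expR_gt0// expR_ge1Dx.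
have h3 : (b - a) * expR (- a) <= (b - a) * expR b.
  by rewrite ler_wpM2l ?subr_ge0// ler_expR; lra.
by rewrite /sinh; lra.
Qed.

(** With c an endpoint of the interval, this primitive vanishes at c, and the
    two halves of the tent contribute equally to its integrals. *)
Lemma is_derive_sinh_sqr_primitive (l c x : R) : l != 0 ->
  is_derive x (1 : R)
    (fun y => (sinh (l * (y - c)) * cosh (l * (y - c)) / l - (y - c)) / 2)
    (sinh (l * (x - c)) ^+ 2).
Proof.
move=> l0.
have dC := @is_derive_fcomp _ cosh (fun y => l * (y - c)) x _ _
    (is_derive_cosh _) (is_derive_affine l c x).
have dS := @is_derive_fcomp _ sinh (fun y => l * (y - c)) x _ _
    (is_derive_sinh _) (is_derive_affine l c x).
have D := is_derive_fadd
  (is_derive_fmul (is_derive_fmul dS dC) (is_derive_cst ((2 * l)^-1) x 1))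
  (is_derive_affine (- 2^-1) c x).
rewrite (_ : (fun y => _) = fun y => sinh (l * (y - c)) * cosh (l * (y - c)) *
  (2 * l)^-1 + - 2^-1 * (y - c)); last first.
  by apply/funext => y; field.
apply: is_derive_eq D _; rewrite /=.
transitivity ((sinh (l * (x - c)) ^+ 2 + cosh (l * (x - c)) ^+ 2 - 1) / 2).
  by field.
by rewrite sqr_cosh; field.
Qed.

End hyperbolic.

Create HintDb smooth.
#[global] Hint Resolve smooth_cst smooth_id smoothD smoothM smoothN smooth_sqr
  smooth_cosh smooth_sinh : smooth.

(** * A smooth approximation of the tent function *)

(** Handles the junction point of functions that are glued with 0. *)
Lemma is_derive_quadratic0 {R : realType} (f : R -> R) (C : R) :
  f 0 = 0 -> (forall x, `|f x| <= C * x ^+ 2) -> is_derive (0 : R) 1 f 0.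
Proof.
move=> f0 fC.
have C0 : 0 <= C by have := fC 1; rewrite expr1n mulr1; exact: le_trans.
have cv : (fun h : R => h^-1 *: (f (h *: 1 + 0) - f 0)) @ (0 : R)^' --> (0 : R).
  apply/cvgrPdist_le => e e0; near=> h.
  have h0 : h != 0 by near: h; exact: nbhs_dnbhs_neq.
  rewrite sub0r normrN f0 subr0 addr0 /GRing.scale /= mulr1 normrM normfV.
  rewrite ler_pdivrMl ?normr_gt0// (le_trans (fC h))//.
  rewrite -real_normK ?num_real// expr2 mulrCA ler_wpM2l//.
  have : `|h| <= e / (C + 1).
    near: h; apply: dnbhs0_le; by rewrite divr_gt0// ltr_wpDl.
  rewrite ler_pdivlMr ?ltr_wpDl// => /(le_trans _)->//.
  by rewrite mulrC ler_wpM2l// lerDl.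
apply: DeriveDef; last by apply/cvg_lim => //.
by apply/cvg_ex; exists 0.
Unshelve. all: by end_near. Qed.

(** The functions x^-k e^(-1/x), extended by 0 for x <= 0.  They are considered
    for all k at once because the family is stable under differentiation. *)
Definition flat {R : realType} (k : nat) (x : R) : R :=
  if 0 < x then x^-1 ^+ k * expR (- x^-1) else 0.

Lemma flat_le0 {R : realType} k (x : R) : x <= 0 -> flat k x = 0.
Proof. by rewrite /flat leNgt => /negbTE->. Qed.

Lemma flat_gt0 {R : realType} k (x : R) :
  0 < x -> flat k x = x^-1 ^+ k * expR (- x^-1).
Proof. by rewrite /flat => ->. Qed.

Lemma flat_ge0 {R : realType} k (x : R) : 0 <= flat k x.
Proof.
rewrite /flat; case: ifPn => // x0.
by rewrite mulr_ge0 ?expR_ge0// exprn_ge0// invr_ge0 ltW.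
Qed.

(** From e^y >= y^(k+2) / (k+2)! at y = 1 / x. *)
Lemma flat_quadratic {R : realType} k (x : R) :
  `|flat k x| <= k.+2`!%:R * x ^+ 2.
Proof.
rewrite ger0_norm ?flat_ge0// /flat; case: ifPn => [x0|_]; last first.
  by rewrite mulr_ge0 ?ler0n// sqr_ge0.
have y0 : 0 < x^-1 by rewrite invr_gt0.
have := @expR_ge1Dxn R x^-1 k.+1 (ltW y0).
move=> /(le_trans _) H; have {}H : x^-1 ^+ k.+2 / k.+2`!%:R <= expR x^-1.
  by apply: H; rewrite lerDr.
rewrite expRN ler_pdivrMr ?expR_gt0//.
have f0 : 0 < k.+2`!%:R :> R by rewrite ltr0n fact_gt0.
move: H; rewrite ler_pdivrMr// => H.
have -> : x^-1 ^+ k = x ^+ 2 * x^-1 ^+ k.+2.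
  by rewrite (exprS _ k.+1) (exprS _ k); field; rewrite gt_eqF.
rewrite [leRHS](_ : _ = x ^+ 2 * (expR x^-1 * k.+2`!%:R)); last by ring.
by rewrite ler_wpM2l ?sqr_ge0.
Qed.

Lemma is_derive_flat {R : realType} k (x : R) :
  is_derive x 1 (flat k) (flat k.+2 x + (- k%:R) * flat k.+1 x).
Proof.
have [x0|x0|->] := ltgtP x 0.
- rewrite !flat_le0 ?ltW// mulr0 addr0.
  apply: (@near_eq_is_derive _ _ _ (fun=> 0)).
  near=> y; rewrite flat_le0// ltW//; near: y; exact: lt_nbhsl.
- rewrite !flat_gt0//.
  have dV : is_derive x 1 (fun y : R => y^-1) (- x ^- 2).
    have := @is_deriveV _ (fun y => y) x 1 1 _ _.
    by rewrite /GRing.scale/= mulr1; apply; rewrite gt_eqF.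
  have D : is_derive x 1 (fun y : R => y^-1 ^+ k * expR (- y^-1))
      (x^-1 ^+ k.+2 * expR (- x^-1) +
       (- k%:R) * (x^-1 ^+ k.+1 * expR (- x^-1))).
    have -> : (fun y : R => y^-1 ^+ k * expR (- y^-1)) =
        (fun y : R => y^-1) ^+ k * (expR \o - (fun y : R => y^-1)).
      by apply/funext => y; rewrite /= exprfctE.
    apply: is_derive_eq.
    rewrite /GRing.scale/= !exprfctE /= opprK.
    rewrite (_ : (- (fun y : R => y^-1)) x = - x^-1)//.
    case: k => [|k] /=; first by rewrite !mul0r mulr0 ?expr0; field; rewrite gt_eqF.
    by rewrite -exprVn !exprS; ring.
  apply: near_eq_is_derive D.
  by near=> y; rewrite flat_gt0//; near: y; exact: lt_nbhsr.
- rewrite (flat_le0 k.+2)// (flat_le0 k.+1)// mulr0 addr0.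
  by apply: is_derive_quadratic0 (flat_quadratic k); rewrite flat_le0.
Unshelve. all: by end_near. Qed.

Lemma smooth_flat {R : realType} n k : smooth n (@flat R k).
Proof.
elim: n k => [//|n IH] k.
exists (fun x => flat k.+2 x + (- k%:R) * flat k.+1 x).
  exact: is_derive_flat.
by apply: smoothD => //; apply: smoothM => //; exact: smooth_cst.
Qed.

(** A smooth positive part: y e^(-1/y) for y > 0.  Its slope (1 + 1/y) e^(-1/y)
    lies in [0, 1], by 1 + z <= e^z at z = 1/y, so that smoothing with it never
    increases a derivative. *)
Definition theta {R : realType} (y : R) : R := y * flat 0 y.

Definition dtheta {R : realType} (y : R) : R := flat 0 y + y * flat 2 y.

Lemma is_derive_theta {R : realType} (y : R) :
  is_derive y (1 : R) theta (dtheta y).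
Proof.
have H := is_derive_fmul (is_derive_id y 1) (is_derive_flat 0 y).
rewrite (_ : dtheta y = y * (flat 2 y + (- 0%:R) * flat 1 y) + flat 0 y * 1).
  exact: H.
by rewrite /dtheta; ring.
Qed.

Lemma smooth_theta {R : realType} n : smooth n (@theta R).
Proof. by apply: smoothM; [exact: smooth_id|exact: smooth_flat]. Qed.

Lemma theta_le0 {R : realType} (y : R) : y <= 0 -> theta y = 0.
Proof. by move=> y0; rewrite /theta flat_le0// mulr0. Qed.

Lemma theta_ge0 {R : realType} (y : R) : 0 <= theta y.
Proof.
have [y0|/ltW y0] := leP y 0; first by rewrite theta_le0.
by rewrite mulr_ge0// flat_ge0.
Qed.

Lemma theta_le {R : realType} (y : R) : 0 <= y -> theta y <= y.
Proof.
rewrite le_eqVlt => /predU1P[<-|y0]; first by rewrite theta_le0.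
rewrite /theta flat_gt0// expr0 mul1r ler_piMr ?(ltW y0)// expR_le1.
by rewrite oppr_le0 invr_ge0 ltW.
Qed.

Lemma theta_ge {R : realType} (y : R) : y - 1 <= theta y.
Proof.
have [y0|y0] := leP y 0; first by rewrite theta_le0//; lra.
rewrite /theta flat_gt0// expr0 mul1r.
have := expR_ge1Dx (- y^-1) => /(ler_wpM2l (ltW y0)).
by rewrite mulrDr mulr1 mulrN mulfV ?gt_eqF.
Qed.

Lemma dtheta_le0 {R : realType} (y : R) : y <= 0 -> dtheta y = 0.
Proof. by move=> y0; rewrite /dtheta !flat_le0// mulr0 addr0. Qed.

Lemma dtheta01 {R : realType} (y : R) : 0 <= dtheta y <= 1.
Proof.
have [y0|y0] := leP y 0; first by rewrite dtheta_le0// lexx ler01.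
rewrite /dtheta addr_ge0 ?mulr_ge0 ?flat_ge0 ?(ltW y0)//=.
rewrite !flat_gt0// expr0 mul1r.
rewrite (_ : _ + _ = expR (- y^-1) * (1 + y^-1)); last by field; rewrite gt_eqF.
by rewrite expRN mulrC ler_pdivrMr ?expR_gt0// mul1r expR_ge1Dx.
Qed.

Definition softpos {R : realType} (e y : R) : R := e * theta (y / e).

Definition softabs {R : realType} (e y : R) : R := softpos e y + softpos e (- y).

(** The tent h - |x - h|, smoothed at its top and at its two feet.  The shift by
    2 e makes the support a compact subset of the open interval: the error of
    [softabs] is at most e, hence the function vanishes where
    h - e <= |x - h|. *)
Definition softtent {R : realType} (e h x : R) : R :=
  softpos e (h - 2 * e - softabs e (x - h)).

Definition dsofttent {R : realType} (e h x : R) : R :=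
  - dtheta ((h - 2 * e - softabs e (x - h)) / e) *
    (dtheta ((x - h) / e) - dtheta (- (x - h) / e)).

Section softtent.
Context {R : realType} (e : R) (e0 : 0 < e).

Lemma is_derive_softpos (y : R) :
  is_derive y (1 : R) (softpos e) (dtheta (y / e)).
Proof.
have dl : is_derive y (1 : R) (fun y => y / e) e^-1.
  have -> : (fun y => y / e) = (e^-1 \*: (id : R -> R)).
    by apply/funext => z; rewrite /= /GRing.scale/= mulrC.
  by apply: is_derive_eq; rewrite /GRing.scale/= mulr1.
have dt := @is_derive_fcomp _ theta (fun y => y / e) y _ _ (is_derive_theta _) dl.
have D := is_derive_fmul (is_derive_cst e y 1) dt.
rewrite (_ : dtheta _ = e * (dtheta (y / e) * e^-1) + theta (y / e) * 0).
  exact: D.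
by field; rewrite gt_eqF.
Qed.

Lemma smooth_softpos n : smooth n (softpos e).
Proof.
apply: smoothM; first exact: smooth_cst.
apply: (smooth_comp (smooth_theta n)).
by apply: smoothM; [exact: smooth_id|exact: smooth_cst].
Qed.

Lemma softpos_ge0 y : 0 <= softpos e y.
Proof. by rewrite mulr_ge0 ?(ltW e0)// theta_ge0. Qed.

Lemma softpos_le0 y : y <= 0 -> softpos e y = 0.
Proof. by move=> y0; rewrite /softpos theta_le0 ?mulr0// pmulr_lle0 ?invr_gt0. Qed.

Lemma softpos_le y : 0 <= y -> softpos e y <= y.
Proof.
move=> y0; have := @theta_le R (y / e).
rewrite divr_ge0 ?(ltW e0)// => /(_ isT).
by rewrite ler_pdivlMr// mulrC.
Qed.

Lemma softpos_ge y : y - e <= softpos e y.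
Proof.
have := ler_wpM2l (ltW e0) (theta_ge (y / e)).
by rewrite mulrBr mulr1 mulrCA mulfV ?gt_eqF// mulr1.
Qed.

Lemma softabs_le y : softabs e y <= `|y|.
Proof.
rewrite /softabs; have [y0|y0] := ger0P y.
  by rewrite (@softpos_le0 (- y)) ?oppr_le0// addr0 softpos_le.
by rewrite (@softpos_le0 y) ?(ltW y0)// add0r softpos_le// oppr_ge0 (ltW y0).
Qed.

Lemma softabs_ge y : `|y| - e <= softabs e y.
Proof.
rewrite /softabs; have [y0|y0] := ger0P y.
  by rewrite (@softpos_le0 (- y)) ?oppr_le0// addr0 softpos_ge.
by rewrite (@softpos_le0 y) ?(ltW y0)// add0r softpos_ge.
Qed.

Variable h : R.

Lemma is_derive_softtent (x : R) :
  is_derive x (1 : R) (softtent e h) (dsofttent e h x).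
Proof.
have dxh : is_derive x (1 : R) (fun x => x - h) 1.
  have D := @is_deriveB _ _ _ id (cst h) x 1 _ _ (is_derive_id _ _) (is_derive_cst _ _ _).
  by rewrite -[X in is_derive _ _ _ X]subr0; exact: D.
have dhx : is_derive x (1 : R) (fun x => - (x - h)) (- 1).
  exact: is_deriveN.
have d1 := @is_derive_fcomp _ (softpos e) (fun x => x - h) x _ _ (is_derive_softpos _) dxh.
have d2 := @is_derive_fcomp _ (softpos e) (fun x => - (x - h)) x _ _ (is_derive_softpos _) dhx.
have d3 : is_derive x (1 : R) (fun x => softabs e (x - h)) _ := is_deriveD d1 d2.
have d4 := @is_deriveB _ _ _ (cst (h - 2 * e)) (fun x => softabs e (x - h))
  x 1 _ _ (is_derive_cst _ _ _) d3.
have d5 := @is_derive_fcomp _ (softpos e) (fun x => h - 2 * e - softabs e (x - h)) x _ _ (is_derive_softpos _) d4.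
rewrite (_ : dsofttent e h x =
  dtheta ((h - 2 * e - softabs e (x - h)) / e) *
  (0 - (dtheta ((x - h) / e) * 1 + dtheta (- (x - h) / e) * - 1))).
  exact: d5.
by rewrite /dsofttent; ring.
Qed.

Lemma smooth_softtent n : smooth n (softtent e h).
Proof.
have sxh : smooth n (fun x => x - h).
  by apply: smoothD; [exact: smooth_id|exact: smooth_cst].
apply: (smooth_comp (smooth_softpos n)).
apply: smoothD; first exact: smooth_cst.
apply/smoothN/smoothD; first exact: (smooth_comp (smooth_softpos n)).
by apply: (smooth_comp (smooth_softpos n)); exact: smoothN.
Qed.

Lemma softtent_ge0 x : 0 <= softtent e h x.
Proof. exact: softpos_ge0. Qed.

Lemma softtent_le x : 0 <= h - `|x - h| -> softtent e h x <= h - `|x - h|.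
Proof.
move=> t0; have := softabs_ge (x - h); rewrite /softtent => ?.
have [y0|y0] := leP (h - 2 * e - softabs e (x - h)) 0.
  by rewrite softpos_le0.
by apply: le_trans (softpos_le (ltW y0)) _; have := e0; lra.
Qed.

Lemma softtent_ge x : h - `|x - h| - 3 * e <= softtent e h x.
Proof.
have := softabs_le (x - h) => ?.
by apply: le_trans (softpos_ge _); lra.
Qed.

Lemma softtent_eq0 x : h - e <= `|x - h| -> softtent e h x = 0.
Proof. by have := softabs_ge (x - h) => ? ?; apply: softpos_le0; lra. Qed.

(** One of the two terms of the derivative of [softabs] always vanishes, so
    that its slope is at most 1 in absolute value. *)
Lemma dsofttent_le1 x : `|dsofttent e h x| <= 1.
Proof.
rewrite /dsofttent normrM normrN; apply: mulr_ile1; rewrite ?normr_ge0//.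
  by have /andP[? ?] := dtheta01 ((h - 2 * e - softabs e (x - h)) / e); rewrite ger0_norm.
have [y0|y0] := leP (x - h) 0.
  rewrite (@dtheta_le0 _ ((x - h) / e)) ?pmulr_lle0 ?invr_gt0// sub0r normrN.
  by have /andP[? ?] := dtheta01 (- (x - h) / e); rewrite ger0_norm.
rewrite (@dtheta_le0 _ (- (x - h) / e)) ?pmulr_lle0 ?invr_gt0 ?oppr_le0 ?(ltW y0)// subr0.
by have /andP[? ?] := dtheta01 ((x - h) / e); rewrite ger0_norm.
Qed.

End softtent.

(** * Integrals and norms on the interval *)

Section integrals.
Context {R : realType}.
Notation mu := (@lebesgue_measure R).

Lemma continuous_integrable (f : R -> R) (a b : R) :
  continuous f -> mu.-integrable `[a, b] (EFin \o f).
Proof.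
move=> cf; apply: continuous_compact_integrable; first exact: segment_compact.
exact: continuous_subspaceT.
Qed.

Lemma Rintegral_derive (P p : R -> R) (a b : R) : a <= b ->
  (forall x, is_derive x (1 : R) P (p x)) -> continuous p ->
  \int[mu]_(x in `[a, b]) p x = P b - P a.
Proof.
rewrite le_eqVlt => /predU1P[<- _ _|ab Pp cp].
  by rewrite set_itv1 Rintegral_set1 subrr.
have cP := is_derive_continuous Pp.
rewrite /Rintegral (@continuous_FTC2 _ _ P)//.
- exact: continuous_subspaceT.
- split; first by move=> x _; exact: (@ex_derive _ _ _ _ _ _ _ (Pp x)).
    exact/cvg_at_right_filter/cP.
  exact/cvg_at_left_filter/cP.
- by move=> x _; rewrite derive1E (@derive_val _ _ _ _ _ _ _ (Pp x)).
Qed.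

Lemma Rintegral_split (f : R -> R) (a b c : R) : a <= b -> b <= c ->
  continuous f ->
  \int[mu]_(x in `[a, c]) f x =
  \int[mu]_(x in `[a, b]) f x + \int[mu]_(x in `[b, c]) f x.
Proof.
move=> ab bc cf; have iac := continuous_integrable a c cf.
have := @Rintegral_itvB R f (BLeft a) (BRight c) b iac.
rewrite !bnd_simp => /(_ ab bc) H.
rewrite -[X in _ + X]Rintegral_itv_obnd_cbnd.
  by rewrite -H addrC subrK.
apply: integrableS (continuous_integrable b c cf) => //.
by apply: subset_itvr; rewrite bnd_simp.
Qed.

(** Integrals are only ever compared with increments of an explicit function,
    through a pointwise comparison of the integrands. *)
Lemma le_Rintegral_derive (P p q : R -> R) (a b : R) : a <= b ->
  (forall x, is_derive x (1 : R) P (p x)) -> continuous p -> continuous q ->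
  (forall x, a <= x <= b -> p x <= q x) ->
  P b - P a <= \int[mu]_(x in `[a, b]) q x.
Proof.
move=> ab Pp cp cq pq; rewrite -(Rintegral_derive ab Pp cp).
apply: le_Rintegral => //.
- exact: continuous_integrable.
- exact: continuous_integrable.
Qed.

Lemma ge_Rintegral_derive (P p q : R -> R) (a b : R) : a <= b ->
  (forall x, is_derive x (1 : R) P (p x)) -> continuous p -> continuous q ->
  (forall x, a <= x <= b -> q x <= p x) ->
  \int[mu]_(x in `[a, b]) q x <= P b - P a.
Proof.
move=> ab Pp cp cq pq; rewrite -(Rintegral_derive ab Pp cp).
apply: le_Rintegral => //.
- exact: continuous_integrable.
- exact: continuous_integrable.
Qed.

End integrals.

Section norms.
Context {R : realType} (L : R).
Notation mu := (@lebesgue_measure R).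

Lemma norm2_ge0 (u : R -> R) : 0 <= norm2 L u.
Proof. by rewrite /norm2 fine_ge0// Lnorm_ge0. Qed.

Lemma in_L2_measurable (u : R -> R) : in_L2 L u ->
  measurable_fun [set: R] (u \_ `]0, L[).
Proof. by rewrite /in_L2 inE => /andP[/[!inE]]. Qed.

Lemma in_L2_fin_num (u : R -> R) : in_L2 L u ->
  ('N[mu]_2%:E [EFin \o (u \_ `]0, L[)%R])%E \is a fin_num.
Proof.
rewrite /in_L2 inE => /andP[_ /[!inE]/= h].
by rewrite ge0_fin_numE// Lnorm_ge0.
Qed.

Lemma norm2E (u : R -> R) : in_L2 L u ->
  ((norm2 L u)%:E = 'N[mu]_2%:E [EFin \o (u \_ `]0, L[)%R])%E.
Proof. by move=> uL; rewrite /norm2 fineK// in_L2_fin_num. Qed.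

Lemma sqr_norm2 (u : R -> R) : in_L2 L u ->
  ((norm2 L u ^+ 2)%:E = \int[mu]_x ((u \_ `]0, L[) x ^+ 2)%:E)%E.
Proof.
move=> uL; rewrite -powR_mulrn ?norm2_ge0// -poweR_EFin norm2E//.
rewrite poweR_Lnorm//.
by apply: eq_integral => x _; rewrite /= powR_mulrn// real_normK// num_real.
Qed.

Lemma norm2_triangle (u v w : R -> R) :
  in_L2 L u -> in_L2 L v -> in_L2 L w -> (forall x, u x = v x + w x) ->
  norm2 L u <= norm2 L v + norm2 L w.
Proof.
move=> uL vL wL uvw; rewrite -lee_fin EFinD !norm2E//.
have -> : u \_ `]0, L[ = (v \_ `]0, L[) \+ (w \_ `]0, L[).
  apply/funext => x; rewrite /= !patchE; case: ifP => _; first exact: uvw.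
  by rewrite /point/= addr0.
by apply: minkowski_EFin; rewrite ?ler1n//; exact: in_L2_measurable.
Qed.

Lemma integral_restrict_oo (f : R -> R) : continuous f ->
  (\int[mu]_x ((f \_ `]0, L[) x)%:E = (\int[mu]_(x in `[0%R, L]) f x)%:E)%E.
Proof.
move=> cf; have mf : measurable_fun `]0%R, L[ f.
  by apply: measurable_funTS; exact: continuous_measurable_fun.
under eq_integral do rewrite -[_%:E]/((EFin \o (f \_ _)) _) -restrict_EFin.
rewrite -integral_mkcond.
rewrite -(@integral_itv_bndoo _ _ _ _ true false)/=; last first.
  exact/measurable_EFinP.
by rewrite /Rintegral fineK// integrable_fin_num//; exact: continuous_integrable.
Qed.

Lemma continuous_in_L2 (u : R -> R) : continuous u -> in_L2 L u.
Proof.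
move=> cu; have mu' : measurable_fun `]0%R, L[ u.
  by apply: measurable_funTS; exact: continuous_measurable_fun.
rewrite /in_L2 inE; apply/andP; split; rewrite inE/=.
  by apply/(measurable_restrictT u (measurable_itv _)).
rewrite /finite_norm unlock poweR_lty//.
under eq_integral => x _.
  rewrite /= powR_mulrn// real_normK ?num_real//.
  rewrite (_ : (u \_ `]0, L[) x ^+ 2 = ((fun x => u x ^+ 2) \_ `]0, L[) x); last first.
    by rewrite !patchE; case: ifP => // _; rewrite /point/= expr0n.
  over.
by rewrite integral_restrict_oo ?ltry//; exact: continuous_sqr.
Qed.

Lemma sqr_norm2_continuous (u : R -> R) : continuous u ->
  norm2 L u ^+ 2 = \int[mu]_(x in `[0%R, L]) (u x ^+ 2).
Proof.
move=> cu; apply/EFin_inj; rewrite sqr_norm2; last exact: continuous_in_L2.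
rewrite -integral_restrict_oo; last exact: continuous_sqr.
apply: eq_integral => x _; rewrite !patchE; case: ifP => // _.
by rewrite /point/= expr0n.
Qed.

End norms.

Section sup_norm.
Context {R : realType} (L : R).
Notation mu := (@lebesgue_measure R).

Lemma in_L2B (u v : R -> R) : in_L2 L u -> in_L2 L v -> in_L2 L (u \- v).
Proof.
rewrite /in_L2 => uL vL.
have -> : (u \- v) \_ `]0, L[ = (u \_ `]0, L[) + (- (v \_ `]0, L[)).
  apply/funext => x; rewrite /= !patchE [RHS]/GRing.add/= [X in _ = _ + X]/GRing.opp/=.
  by rewrite !patchE; case: ifP => // _; rewrite /point/= subr0.
have p1 : (1 <= 2%:E :> \bar R)%E by rewrite lee_fin ler1n.
have [_ addL] := Lfun_addr_closed mu p1.
by apply: addL => //; exact: Lfun_oppr_closed vL.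
Qed.

Lemma lebesgue_measure_setT_gt0 : (0 < mu [set: R])%E.
Proof.
apply: (@lt_le_trans _ _ (mu `[0%R, 1%R])).
  by rewrite lebesgue_measure_itv/= lte_fin ltr01 sube0 lte_fin ltr01.
by apply: le_measure => //; rewrite inE.
Qed.

Lemma norm_oo_leP (u : R -> R) (M : R) :
  reflect (\forall x \ae mu, `|(u \_ `]0, L[) x| <= M) (norm_oo L u <= M%:E)%E.
Proof.
have -> : norm_oo L u = ess_sup mu (abse \o (EFin \o (u \_ `]0, L[))).
  by rewrite /norm_oo unlock lebesgue_measure_setT_gt0.
by apply: (iffP (@ess_supP _ _ _ mu _ _)) => -[N [mN N0 sub]]; exists N; split => //;
  apply: subset_trans sub => x /=; rewrite lee_fin.
Qed.

Lemma sqr_norm2_ge (u : R -> R) (A : set R) (eta : R) :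
  in_L2 L u -> measurable A -> 0 <= eta ->
  (forall x, A x -> eta <= `|(u \_ `]0, L[) x|) ->
  ((eta ^+ 2)%:E * mu A <= (norm2 L u ^+ 2)%:E)%E.
Proof.
move=> uL mA eta0 Au; rewrite sqr_norm2//.
have mU := in_L2_measurable uL.
rewrite -integral_cst//.
apply: (@le_trans _ _ (\int[mu]_(x in A) ((u \_ `]0%R, L[) x ^+ 2)%:E)%E).
  apply: ge0_le_integral => //.
  - by move=> x _; rewrite lee_fin sqr_ge0.
  - by apply/measurable_EFinP; apply: measurable_funTS; exact: measurable_funX.
  - move=> x Ax; rewrite lee_fin -[leRHS]real_normK ?num_real//.
    by rewrite ler_sqr ?nnegrE// Au.
apply: ge0_subset_integral => //.
- by apply/measurable_EFinP; exact: measurable_funX.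
- by move=> x _; rewrite lee_fin sqr_ge0.
Qed.

(** Where |u| exceeds M + eta, an approximant phi is at distance at least
    eta / 2 from u, and Chebyshev's inequality bounds the measure of that set
    by (2 e / eta)^2 for every small e. *)
Lemma norm_oo_le_approx (u : R -> R) (M : R) : in_L2 L u ->
  (forall e : R, 0 < e -> exists phi : R -> R,
    [/\ in_L2 L phi, norm2 L (u \- phi) < e & forall x, `|phi x| <= M + e]) ->
  (norm_oo L u <= M%:E)%E.
Proof.
move=> uL H; apply/lee_addgt0Pr => eta eta0; rewrite -EFinD.
have mU := in_L2_measurable uL.
have M0 e : 0 < e -> 0 <= M + e.
  by move=> /H [phi [_ _]] /(_ 0); exact: le_trans.
pose A := [set x | M + eta < `|(u \_ `]0, L[) x|].
have mA : measurable A.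
  rewrite (_ : A = setT `&` (Num.norm \o (u \_ `]0, L[)) @^-1` `]M + eta, +oo[%classic).
    by apply: (measurableT_comp (@normr_measurable _ _) mU) => //; exact: measurable_itv.
  by apply/seteqP; split=> x /=; rewrite in_itv/= andbT// => -[].
suff muA : mu A = 0%E.
  apply/norm_oo_leP; exists A; split => // x /=.
  by move=> /negP; rewrite -ltNge.
have muAe e : 0 < e -> e <= eta / 2 -> (((eta / 2) ^+ 2)%:E * mu A <= (e ^+ 2)%:E)%E.
  move=> e0 eeta; have [phi [phiL uphi phiM]] := H e e0.
  have upL := in_L2B uL phiL.
  apply: (@le_trans _ _ ((norm2 L (u \- phi) ^+ 2)%:E)); last first.
    rewrite lee_fin ler_sqr ?nnegrE ?norm2_ge0 ?ltW//.
  apply: sqr_norm2_ge => //; first by rewrite divr_ge0// ltW.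
  move=> x; rewrite /A /= !patchE; case: ifPn => _ Ax; last first.
    by move: Ax; rewrite /point/= normr0 => /lt_geF; rewrite M0.
  have := phiM x; have := lerB_normD (u x) (- phi x); rewrite normrN.
  lra.
have : (((eta / 2) ^+ 2)%:E * mu A = 0)%E.
  apply/eqP; rewrite eq_le mule_ge0 ?lee_fin ?sqr_ge0// andbT.
  apply/lee_addgt0Pr => d d0; rewrite add0e.
  pose e := Num.min (eta / 2) (Num.min 1 d).
  have e0 : 0 < e by rewrite !lt_min ltr01 d0 divr_gt0.
  apply: le_trans (muAe e e0 _) _; first by rewrite ge_min lexx.
  have e1 : e <= 1 by rewrite !ge_min lexx orbT.
  have ed : e <= d by rewrite !ge_min lexx !orbT.
  by rewrite lee_fin; apply: le_trans ed; rewrite expr2 ler_piMr// ltW.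
move/eqP; rewrite mule_eq0 => /orP[|/eqP//].
by rewrite eqe sqrf_eq0 gt_eqF// divr_gt0.
Qed.

End sup_norm.

(** * The sup-norm is controlled by the energy *)

Section energy.
Context {R : realType}.
Notation mu := (@lebesgue_measure R).

(** Valid for any pair with C' = l S and S' = l C: the expansion of
    (phi' - c C)^2 + (l phi - c S)^2 is the energy density minus the derivative
    of 2 c phi C - c^2 / l S C. *)
Lemma energy_ge (phi dphi C S : R -> R) (l c a b : R) : a <= b -> l != 0 ->
  (forall x, is_derive x (1 : R) phi (dphi x)) ->
  (forall x, is_derive x (1 : R) C (l * S x)) ->
  (forall x, is_derive x (1 : R) S (l * C x)) ->
  smooth 1 phi -> smooth 1 dphi -> smooth 1 C -> smooth 1 S ->
  2 * c * (phi b * C b - phi a * C a) - c ^+ 2 / l * (S b * C b - S a * C a) <=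
  \int[mu]_(x in `[a, b]) (dphi x ^+ 2 + l ^+ 2 * phi x ^+ 2).
Proof.
move=> ab l0 dP dC dS sphi sdphi sC sS.
pose P y := 2 * c * (phi y * C y) - c ^+ 2 / l * (S y * C y).
pose p y := 2 * c * (phi y * (l * S y) + C y * dphi y)
  - c ^+ 2 / l * (S y * (l * S y) + C y * (l * C y)).
have Pp x : is_derive x (1 : R) P (p x).
  have D1 := is_derive_fmul (is_derive_cst (2 * c) x 1) (is_derive_fmul (dP x) (dC x)).
  have D2 := is_derive_fmul (is_derive_cst (- (c ^+ 2 / l)) x 1)
    (is_derive_fmul (dS x) (dC x)).
  have D := is_derive_fadd D1 D2.
  rewrite (_ : P = fun y => 2 * c * (phi y * C y) + - (c ^+ 2 / l) * (S y * C y)).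
    by apply: is_derive_eq D _; rewrite /p /=; ring.
  by apply/funext => y; rewrite /P mulNr.
rewrite (_ : _ - _ = P b - P a); last by rewrite /P; ring.
apply: (le_Rintegral_derive ab Pp).
- apply: smooth_continuous; rewrite /p; auto 20 with smooth.
- apply: smooth_continuous; auto 20 with smooth.
- move=> x _; rewrite -subr_ge0 /p.
  rewrite (_ : _ - _ = (dphi x - c * C x) ^+ 2 + (l * phi x - c * S x) ^+ 2).
    by rewrite addr_ge0// sqr_ge0.
  by field.
Qed.

(** The optimal c makes the bound quadratic in the value of phi at the free
    endpoint. *)
Lemma energy_left (phi dphi : R -> R) (l a b : R) : a < b -> 0 < l ->
  (forall x, is_derive x (1 : R) phi (dphi x)) ->
  smooth 1 phi -> smooth 1 dphi -> phi a = 0 ->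
  phi b ^+ 2 * l * cosh (l * (b - a)) / sinh (l * (b - a)) <=
  \int[mu]_(x in `[a, b]) (dphi x ^+ 2 + l ^+ 2 * phi x ^+ 2).
Proof.
move=> ab l0 dP sphi sdphi pa0.
have sg : 0 < sinh (l * (b - a)) by rewrite sinh_gt0// mulr_gt0// subr_gt0.
pose c := phi b * l / sinh (l * (b - a)).
have := @energy_ge phi dphi (fun y => cosh (l * (y - a)))
  (fun y => sinh (l * (y - a))) l c a b (ltW ab) (lt0r_neq0 l0) dP.
have dC x : is_derive x (1 : R) (fun y => cosh (l * (y - a))) (l * sinh (l * (x - a))).
  rewrite mulrC; exact: (@is_derive_fcomp _ cosh (fun y => l * (y - a)) x _ _
    (is_derive_cosh _) (is_derive_affine l a x)).
have dS x : is_derive x (1 : R) (fun y => sinh (l * (y - a))) (l * cosh (l * (x - a))).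
  rewrite mulrC; exact: (@is_derive_fcomp _ sinh (fun y => l * (y - a)) x _ _
    (is_derive_sinh _) (is_derive_affine l a x)).
move=> /(_ dC dS sphi sdphi).
move=> /(_ (smooth_comp (smooth_cosh 1) (smooth_affine 1 l a))).
move=> /(_ (smooth_comp (smooth_sinh 1) (smooth_affine 1 l a))).
apply: le_trans; rewrite subrr mulr0 sinh0 pa0 le_eqVlt; apply/orP; left; apply/eqP.
by rewrite /c; field; rewrite !gt_eqF.
Qed.

Lemma energy_right (phi dphi : R -> R) (l a b : R) : a < b -> 0 < l ->
  (forall x, is_derive x (1 : R) phi (dphi x)) ->
  smooth 1 phi -> smooth 1 dphi -> phi b = 0 ->
  phi a ^+ 2 * l * cosh (l * (b - a)) / sinh (l * (b - a)) <=
  \int[mu]_(x in `[a, b]) (dphi x ^+ 2 + l ^+ 2 * phi x ^+ 2).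
Proof.
move=> ab l0 dP sphi sdphi pb0.
have sg : 0 < sinh (l * (b - a)) by rewrite sinh_gt0// mulr_gt0// subr_gt0.
pose c := - (phi a * l / sinh (l * (b - a))).
have := @energy_ge phi dphi (fun y => cosh (l * (y - b)))
  (fun y => sinh (l * (y - b))) l c a b (ltW ab) (lt0r_neq0 l0) dP.
have dC x : is_derive x (1 : R) (fun y => cosh (l * (y - b))) (l * sinh (l * (x - b))).
  rewrite mulrC; exact: (@is_derive_fcomp _ cosh (fun y => l * (y - b)) x _ _
    (is_derive_cosh _) (is_derive_affine l b x)).
have dS x : is_derive x (1 : R) (fun y => sinh (l * (y - b))) (l * cosh (l * (x - b))).
  rewrite mulrC; exact: (@is_derive_fcomp _ sinh (fun y => l * (y - b)) x _ _
    (is_derive_sinh _) (is_derive_affine l b x)).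
move=> /(_ dC dS sphi sdphi).
move=> /(_ (smooth_comp (smooth_cosh 1) (smooth_affine 1 l b))).
move=> /(_ (smooth_comp (smooth_sinh 1) (smooth_affine 1 l b))).
apply: le_trans; rewrite subrr mulr0 sinh0 pb0.
rewrite (_ : a - b = - (b - a)); last by rewrite opprB.
rewrite (mulrN l) sinhN coshN.
rewrite le_eqVlt; apply/orP; left; apply/eqP.
by rewrite /c; field; rewrite !gt_eqF.
Qed.

(** The two one-sided bounds add up to coth a + coth b, where a + b is fixed;
    by convexity of coth the worst case is the midpoint.  With E = e^-(a+b), the
    quotient (1 + E) / (1 - E) is coth ((a + b) / 2). *)
Lemma coth_convex (a b : R) : 0 < a -> 0 < b ->
  2 * (1 + expR (- (a + b))) <=
  (1 - expR (- (a + b))) * (cosh a / sinh a + cosh b / sinh b).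
Proof.
move=> a0 b0; rewrite /cosh /sinh !expRN expRD.
set p := expR a; set r := expR b.
have p1 : 1 < p by rewrite expR_gt1.
have r1 : 1 < r by rewrite expR_gt1.
have p0 : 0 < p by lra.
have r0 : 0 < r by lra.
have p2 : 0 < p ^+ 2 - 1 by rewrite subr_gt0 expr_gt1 ?(ltW p0).
have r2 : 0 < r ^+ 2 - 1 by rewrite subr_gt0 expr_gt1 ?(ltW r0).
rewrite -subr_ge0.
rewrite (_ : _ - _ =
  2 * (p * r + 1) * (p - r) ^+ 2 / (p * r * (p ^+ 2 - 1) * (r ^+ 2 - 1))).
  rewrite divr_ge0//.
    by rewrite mulr_ge0 ?sqr_ge0// mulr_ge0// addr_ge0// mulr_ge0// ltW.
  by rewrite !mulr_ge0// ltW.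
by field; rewrite !gt_eqF.
Qed.

End energy.

Section test_functions.
Context {R : realType} (L : R).
Notation mu := (@lebesgue_measure R).

Lemma test_function_out (phi : R -> R) x :
  test_function L phi -> ~~ (0 < x < L) -> phi x = 0.
Proof.
move=> [_ _ sub] x0L; apply/eqP; apply: contraNT x0L => px.
by have := sub x (@subset_closure _ [set x | phi x != 0] x px); rewrite /= in_itv.
Qed.

Lemma test_function_smooth (phi : R -> R) : test_function L phi ->
  [/\ forall x, is_derive x (1 : R) phi (phi^`()%classic x),
      forall n, smooth n phi & forall n, smooth n phi^`()%classic].
Proof.
move=> [dphi _ _]; split.
- by move=> x; rewrite derive1E; apply/derivableP; exact: (dphi 0).
- exact: derivable_smooth.
- by apply: derivable_smooth => n x; rewrite -derive1Sn.
Qed.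

Lemma test_function_in_L2 (phi : R -> R) : test_function L phi ->
  in_L2 L phi /\ in_L2 L phi^`()%classic.
Proof.
move=> /test_function_smooth[_ s s']; split; apply: continuous_in_L2.
  exact/smooth_continuous/s.
exact/smooth_continuous/s'.
Qed.

Definition energy (l : R) (u du : R -> R) : R :=
  norm2 L du ^+ 2 + l ^+ 2 * norm2 L u ^+ 2.

Lemma energyE (l : R) (u du : R -> R) : continuous u -> continuous du ->
  energy l u du = \int[mu]_(x in `[0, L]) (du x ^+ 2 + l ^+ 2 * u x ^+ 2).
Proof.
move=> cu cdu.
have i1 := continuous_integrable 0 L (continuous_sqr cdu).
have i2 := continuous_integrable 0 L (continuous_sqr cu).
rewrite RintegralD//; last first.
  apply: continuous_integrable => x; apply: cvgM; first exact: cvg_cst.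
  exact: (continuous_sqr cu).
by rewrite RintegralZl// -!sqr_norm2_continuous.
Qed.

(** The estimate by the energy, in which (1 - E) / (1 + E) for E = e^(- l L) is
    tanh (l L / 2). *)
Lemma test_function_sup (phi : R -> R) (l x : R) : 0 < L -> 0 < l ->
  test_function L phi ->
  phi x ^+ 2 * (2 * l * (1 + expR (- (l * L)))) <=
  (1 - expR (- (l * L))) * energy l phi phi^`()%classic.
Proof.
move=> L0 l0 tphi.
have E0 : 0 <= energy l phi phi^`()%classic.
  by apply: addr_ge0; [|apply: mulr_ge0]; exact: sqr_ge0.
have t0 : 0 <= 1 - expR (- (l * L)).
  by rewrite subr_ge0 expR_le1 oppr_le0 mulr_ge0// ltW.
have [/andP[x0 xL]|x0L] := boolP (0 < x < L); last first.
  by rewrite (test_function_out tphi x0L) expr0n mul0r mulr_ge0.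
have [dphi sphi sdphi] := test_function_smooth tphi.
have p0 : phi 0 = 0 by apply: (test_function_out tphi); rewrite ltxx.
have pL : phi L = 0 by apply: (test_function_out tphi); rewrite ltxx andbF.
rewrite energyE; [|exact: smooth_continuous..].
rewrite (Rintegral_split (ltW x0) (ltW xL)); last first.
  by apply: smooth_continuous; auto with smooth.
have H1 := energy_left x0 l0 dphi (sphi 1%N) (sdphi 1%N) p0.
have H2 := energy_right xL l0 dphi (sphi 1%N) (sdphi 1%N) pL.
apply: le_trans (ler_wpM2l t0 (lerD H1 H2)).
have := @coth_convex R (l * (x - 0)) (l * (L - x)).
rewrite !mulr_gt0 ?subr_gt0// => /(_ isT isT).
rewrite -mulrDr subr0 subrKC.
have pl : 0 <= phi x ^+ 2 * l by rewrite mulr_ge0 ?sqr_ge0// ltW.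
move=> /(ler_wpM2l pl) H.
rewrite [leLHS](_ : _ = phi x ^+ 2 * l * (2 * (1 + expR (- (l * L))))); last by ring.
by apply: le_trans H _; rewrite le_eqVlt; apply/orP; left; apply/eqP; ring.
Qed.

End test_functions.

Section H10.
Context {R : realType} (L : R) (L0 : 0 < L).
Notation mu := (@lebesgue_measure R).

Lemma norm2_subC (u v : R -> R) : in_L2 L u -> in_L2 L v ->
  norm2 L (u \- v) = norm2 L (v \- u).
Proof.
move=> uL vL; rewrite /norm2 -oppe_Lnorm; congr (fine (Lnorm _ _ _)).
apply/funext => x; rewrite /= !patchE; case: ifP => _; rewrite /point/= ?oppr0//.
by rewrite opprB.
Qed.

(** If both phi and phi' are within d of u and u', the square root of the
    [energy] of phi exceeds that of u by at most (1 + l) d; the bound for test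
    functions then passes to u. *)
Lemma in_H10_sup (u du : R -> R) (l : R) : 0 < l -> in_H10 L u du ->
  (norm_oo L u <= (Num.sqrt ((1 - expR (- (l * L))) / (2 * l * (1 + expR (- (l * L)))))
     * Num.sqrt (energy L l u du))%:E)%E.
Proof.
move=> l0 [uL duL _ approx].
set k := (_ / _); set G := Num.sqrt (energy _ _ _ _).
have E1 : expR (- (l * L)) <= 1 by rewrite expR_le1 oppr_le0 mulr_ge0// ltW.
have Eg : 0 < expR (- (l * L)) by exact: expR_gt0.
have den : 0 < 2 * l * (1 + expR (- (l * L))) by rewrite !mulr_gt0//; lra.
have k0 : 0 <= k by rewrite divr_ge0 ?(ltW den)// subr_ge0.
have G0 : 0 <= G by exact: sqrtr_ge0.
have en0 v dv : 0 <= energy L l v dv.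
  by apply: addr_ge0; [|apply: mulr_ge0]; exact: sqr_ge0.
have GE : G ^+ 2 = energy L l u du by rewrite sqr_sqrtr ?en0.
have s0 := sqrtr_ge0 k.
apply: norm_oo_le_approx => // e e0.
(* An H^1-distance of e / c to u costs e in the bound on phi, and c >= 1 keeps
   the L^2-distance below e. *)
pose c := 1 + Num.sqrt k * (1 + l).
have c1 : 1 <= c by rewrite lerDl mulr_ge0//; lra.
have ec0 : 0 < e / c by rewrite divr_gt0//; lra.
have [phi tphi dist] := approx _ ec0.
have [phiL dphiL] := test_function_in_L2 tphi.
have dle a b : 0 <= a -> 0 <= b -> Num.sqrt (a ^+ 2 + b ^+ 2) < e / c -> a < e / c.
  move=> a0 b0; apply: le_lt_trans.
  by rewrite -[leLHS]ger0_norm// -sqrtr_sqr ler_sqrt ?addr_ge0 ?sqr_ge0// lerDl sqr_ge0.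
have d1 : norm2 L (u \- phi) < e / c by apply: dle dist; exact: norm2_ge0.
have d2 : norm2 L (du \- phi^`()%classic) < e / c.
  by rewrite addrC in dist; apply: dle dist; exact: norm2_ge0.
exists phi; split => // [|x].
  by apply: lt_le_trans d1 _; rewrite ler_pdivrMr; [rewrite ler_peMr// ltW|lra].
have tr1 : norm2 L phi <= norm2 L u + e / c.
  have := norm2_triangle phiL uL (in_L2B phiL uL) (fun x => esym (subrKC _ _)).
  rewrite (norm2_subC phiL uL) => /le_trans; apply.
  by rewrite lerD2l ltW.
have tr2 : norm2 L phi^`()%classic <= norm2 L du + e / c.
  have := norm2_triangle dphiL duL (in_L2B dphiL duL) (fun x => esym (subrKC _ _)).
  rewrite (norm2_subC dphiL duL) => /le_trans; apply.
  by rewrite lerD2l ltW.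
have DG : norm2 L du <= G.
  rewrite -[leLHS](ger0_norm (norm2_ge0 _ _)) -sqrtr_sqr ler_sqrt//.
  by rewrite /energy lerDl mulr_ge0 ?sqr_ge0.
have NG : l * norm2 L u <= G.
  rewrite -[leLHS]ger0_norm ?mulr_ge0 ?norm2_ge0 ?(ltW l0)// -sqrtr_sqr ler_sqrt//.
  by rewrite /energy exprMn lerDr sqr_ge0.
have Ephi : energy L l phi phi^`()%classic <= (G + (1 + l) * (e / c)) ^+ 2.
  rewrite sqrrD GE /energy.
  have := norm2_ge0 L phi; have := norm2_ge0 L phi^`()%classic.
  have := norm2_ge0 L u; have := norm2_ge0 L du.
  move: tr1 tr2 DG NG; rewrite /energy.
  set N' := norm2 L phi; set D' := norm2 L _^`()%classic.
  set N := norm2 L u; set D := norm2 L du; set d := e / c.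
  move=> tr1 tr2 DG NG D0 N0 D'0 N'0.
  have h1 : D' ^+ 2 <= (D + d) ^+ 2 by rewrite ler_sqr ?nnegrE//; lra.
  have h2 : (l * N') ^+ 2 <= (l * (N + d)) ^+ 2.
    by rewrite ler_sqr ?nnegrE ?mulr_ge0 ?ler_pM2l//; lra.
  have d0 : 0 <= d := ltW ec0.
  have h3 : D * d <= G * d by exact: ler_wpM2r.
  have h4 : l * N * (l * d) <= G * (l * d).
    by apply: ler_wpM2r => //; rewrite mulr_ge0// ltW.
  have h5 : 0 <= l * d ^+ 2 by rewrite mulr_ge0 ?sqr_ge0// ltW.
  rewrite sqrrD in h1; rewrite exprMn mulrDr sqrrD in h2.
  lra.
have := test_function_sup x L0 l0 tphi; rewrite -ler_pdivlMr// mulrAC -/k => pk.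
have : phi x ^+ 2 <= (Num.sqrt k * (G + (1 + l) * (e / c))) ^+ 2.
  by apply: le_trans pk _; rewrite exprMn sqr_sqrtr// ler_wpM2l.
have W0 : 0 <= G + (1 + l) * (e / c).
  by rewrite addr_ge0// mulr_ge0 ?(ltW ec0)//; lra.
rewrite -[leLHS]real_normK ?num_real// ler_sqr ?nnegrE ?mulr_ge0// => /le_trans; apply.
rewrite mulrDr lerD2l mulrA mulrA ler_pdivrMr ?(lt_le_trans ltr01)//.
by rewrite mulrA (mulrC e) ler_pM2r// lerDr.
Qed.

End H10.

(** * The strict inequality *)

Section inequality.
Context {R : realType} (L : R) (L0 : 0 < L).
Notation mu := (@lebesgue_measure R).

Lemma norm2_gt0 (u : R -> R) : in_L2 L u -> nonzero L u -> 0 < norm2 L u.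
Proof.
move=> uL nz; rewrite lt_neqAle norm2_ge0 andbT; apply/eqP => N0.
apply: nz.
have mU : measurable_fun [set: R] (EFin \o (u \_ `]0, L[)).
  by apply/measurable_EFinP; exact: in_L2_measurable.
have NE : ('N[mu]_2%:E [EFin \o (u \_ `]0, L[)%R])%E = 0%E by rewrite -norm2E// -N0.
have p0 : (0 < 2%:E :> \bar R)%E by rewrite lte_fin.
have [A [mA A0 sub]] := @Lnorm_eq0_eq0 _ _ _ mu _ _ mU p0 NE.
exists A; split => //; apply: subset_trans sub => x /=; apply: contra_not => /(_ I).
by rewrite /= patchE => + xL; rewrite mem_set// => -[].
Qed.

Lemma norm2_le_sup (u : R -> R) (M : R) : in_L2 L u -> 0 <= M ->
  (norm_oo L u <= M%:E)%E -> norm2 L u ^+ 2 <= L * M ^+ 2.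
Proof.
move=> uL M0 /norm_oo_leP uM; rewrite -lee_fin sqr_norm2//.
have mU := in_L2_measurable uL.
apply: (@le_trans _ _ (\int[mu]_(x in `]0%R, L[) (M ^+ 2)%:E)%E); last first.
  by rewrite integral_cst//= lebesgue_measure_itv/= lte_fin L0 sube0 -EFinM mulrC.
rewrite [leRHS]integral_mkcond.
apply: ae_ge0_le_integral => //.
- by move=> x _; rewrite lee_fin sqr_ge0.
- by apply/measurable_EFinP; exact: measurable_funX.
- by move=> x _; rewrite patchE; case: ifP => _; rewrite ?lee_fin ?sqr_ge0.
- by apply/(measurable_restrictT _ (measurable_itv _)); exact: measurable_cst.
case: uM => A [mA A0 sub]; exists A; split => //; apply: subset_trans sub => x /=.
apply: contra_not => uM _; rewrite !patchE in uM *; case: ifP uM => _ uM.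
  by rewrite lee_fin -[leLHS]real_normK ?num_real// ler_sqr ?nnegrE.
by rewrite /point/= expr0n.
Qed.

Lemma in_H10_sup_sqr (u du : R -> R) : in_H10 L u du ->
  exists M : R, [/\ 0 <= M, norm_oo L u = M%:E & forall l, 0 < l ->
    M ^+ 2 * (2 * l * (1 + expR (- (l * L)))) <=
    (1 - expR (- (l * L))) * (norm2 L du ^+ 2 + l ^+ 2 * norm2 L u ^+ 2)].
Proof.
move=> H.
have sup0 : (0 <= norm_oo L u)%E by exact: Lnorm_ge0.
have fin : norm_oo L u \is a fin_num.
  by rewrite ge0_fin_numE// (le_lt_trans (in_H10_sup L0 ltr01 H))// ltry.
exists (fine (norm_oo L u)); split; [exact: fine_ge0|by rewrite fineK|].
move=> l l0.
have := in_H10_sup L0 l0 H; rewrite -[X in (X <= _)%E]fineK// lee_fin.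
set M := fine _; set k := (_ / _).
have E1 : expR (- (l * L)) <= 1 by rewrite expR_le1 oppr_le0 mulr_ge0// ltW.
have Eg : 0 < expR (- (l * L)) by exact: expR_gt0.
have den : 0 < 2 * l * (1 + expR (- (l * L))) by rewrite !mulr_gt0//; lra.
have k0 : 0 <= k by rewrite divr_ge0 ?(ltW den)// subr_ge0.
have en0 : 0 <= energy L l u du.
  by apply: addr_ge0; [|apply: mulr_ge0]; exact: sqr_ge0.
have M0 : 0 <= M by exact: fine_ge0.
rewrite -ler_sqr ?nnegrE ?mulr_ge0 ?sqrtr_ge0// exprMn !sqr_sqrtr//.
by rewrite /k mulrAC ler_pdivlMr.
Qed.

(** The bound e <= 3, from (7/8)^8 >= 1/3 and 1 - 1/8 <= e^(-1/8). *)
Lemma expRN1_ge : 3^-1 <= expR (- 1) :> R.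
Proof.
have -> : (- 1 : R) = 8%:R * (- 8^-1) by rewrite mulrN mulfV// pnatr_eq0.
rewrite expRM_natl; have h : 7 / 8 <= expR (- 8^-1) :> R.
  by apply: le_trans (expR_ge1Dx _); lra.
apply: (@le_trans _ _ ((7 / 8) ^+ 8)); first by rewrite !exprS expr0; lra.
by rewrite lerXn2r// ?nnegrE ?expR_ge0//; lra.
Qed.

(** Here t = L |u'| / |u| and m = L |u|_oo^2 / |u|^2.  The hypothesis is used
    at s = t - 2 q with q = e^-t.  There e^-s >= q (1 + 2 q), and in
      (1 - X) / (1 + X) (t^2 + s^2) / (2 s)   at   X = q + 2 q^2
    the numerator 1 - X factors as (1 - 2 q) (1 + q); the factor 1 - 2 q is the
    one wanted, and t^2 + s^2 = 2 t s + 4 q^2 leaves t s > 1 + q to check. *)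
Lemma strict_ineq_scalar (t m : R) : 0 < t -> 3 <= t ^+ 2 ->
  (forall s, 0 < s ->
    m * (2 * s * (1 + expR (- s))) <= (1 - expR (- s)) * (t ^+ 2 + s ^+ 2)) ->
  m < t * (1 - 2 * expR (- t)).
Proof.
move=> t0 t3 H; set q := expR (- t).
have q0 : 0 < q by exact: expR_gt0.
have q1 : q * (1 + t) <= 1.
  have := ler_wpM2l (ltW q0) (expR_ge1Dx t).
  by rewrite /q -expRD addNr expR0.
have t1 : 3 / 2 < t by rewrite ltNge; apply/negP => t2; nra.
have q2 : q < 2 / 5 by rewrite ltNge; apply/negP => ?; nra.
have s0 : 0 < t - 2 * q by lra.
have ts : 1 + q < t * (t - 2 * q) by nra.
have := H _ s0; set X := expR (- (t - 2 * q)).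
have X0 : 0 < X by exact: expR_gt0.
have Xq : q + 2 * q ^+ 2 <= X.
  rewrite /X opprB addrC expRD -/q.
  have := ler_wpM2l (ltW q0) (expR_ge1Dx (2 * q)); lra.
rewrite ltNge => H1; apply/negP => mt.
have H2 : t * (1 - 2 * q) * (2 * (t - 2 * q) * (1 + X)) <=
    (1 - X) * (t ^+ 2 + (t - 2 * q) ^+ 2).
  apply: le_trans H1; apply: ler_wpM2r => //.
  by rewrite !mulr_ge0//; lra.
have H3 : t * (1 - 2 * q) * (2 * (t - 2 * q) * (1 + (q + 2 * q ^+ 2))) <=
    (1 - (q + 2 * q ^+ 2)) * (t ^+ 2 + (t - 2 * q) ^+ 2).
  have A1 : 0 <= t * (1 - 2 * q) * (2 * (t - 2 * q)) by rewrite !mulr_ge0//; lra.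
  have A2 : 0 <= t ^+ 2 + (t - 2 * q) ^+ 2 by rewrite addr_ge0// sqr_ge0.
  nra.
have H4 : 0 <= (1 - 2 * q) * (4 * q ^+ 2) * (1 + q - t * (t - 2 * q)).
  rewrite -subr_ge0 in H3; apply: le_trans H3 _.
  by rewrite le_eqVlt; apply/orP; left; apply/eqP; ring.
have : (1 - 2 * q) * (4 * q ^+ 2) * (1 + q - t * (t - 2 * q)) < 0.
  by rewrite pmulr_rlt0 ?subr_lt0// mulr_gt0 ?mulr_gt0 ?exprn_gt0//; lra.
by rewrite ltNge H4.
Qed.

(** The hypothesis t^2 >= 3 of the scalar inequality is a Poincare inequality,
    and it comes from the same energy estimate at l = 1 / L. *)
Lemma in_H10_strict (u du : R -> R) : in_H10 L u du -> nonzero L u ->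
  [/\ 0 < norm2 L u, 0 < norm2 L du & exists2 M : R, norm_oo L u = M%:E &
    M ^+ 2 < norm2 L u * norm2 L du *
      (1 - 2 * expR (- (L * norm2 L du / norm2 L u)))].
Proof.
move=> H nz; have [uL duL _ _] := H.
have N0 := norm2_gt0 uL nz; have D0 := norm2_ge0 L du.
have [M [M0 ME MH]] := in_H10_sup_sqr H.
have NM : norm2 L u ^+ 2 <= L * M ^+ 2.
  by apply: norm2_le_sup => //; rewrite ME.
move: N0 D0 NM MH; set N := norm2 L u; set D := norm2 L du => N0 D0 NM MH.
pose t := L * D / N.
have t0 : 0 <= t by rewrite divr_ge0 ?mulr_ge0// ltW.
have t3 : 3 <= t ^+ 2.
  have := MH L^-1; rewrite invr_gt0 mulVf ?gt_eqF// => /(_ L0).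
  have := expRN1_ge; set E := expR (- 1) => E3 h.
  have h1 : N ^+ 2 * (2 * (1 + E)) <= (1 - E) * ((L * D) ^+ 2 + N ^+ 2).
    apply: (@le_trans _ _ (L * M ^+ 2 * (2 * (1 + E)))).
      by rewrite ler_wpM2r//; lra.
    have := ler_wpM2l (sqr_ge0 L) h; congr (_ <= _); field; by rewrite gt_eqF.
  have h2 : 3 * N ^+ 2 <= (L * D) ^+ 2.
    have E1 : E < 1 by rewrite expR_lt1; lra.
    have : (1 - E) * (3 * N ^+ 2) <= (1 - E) * (L * D) ^+ 2.
      have : 0 <= (E - 3^-1) * N ^+ 2 by rewrite mulr_ge0 ?sqr_ge0//; lra.
      lra.
    by rewrite ler_pM2l//; lra.
  by rewrite /t expr_div_n ler_pdivlMr// exprn_gt0.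
have tgt0 : 0 < t.
  rewrite lt_neqAle t0 andbT; apply/eqP => t00.
  by move: t3; rewrite -t00 expr0n/=; lra.
have Dgt0 : 0 < D by move: tgt0; rewrite /t pmulr_lgt0 ?invr_gt0// pmulr_rgt0.
split => //; exists M => //.
have H1 s : 0 < s -> M ^+ 2 * L / N ^+ 2 * (2 * s * (1 + expR (- s))) <=
    (1 - expR (- s)) * (t ^+ 2 + s ^+ 2).
  move=> s0; have := MH (s / L); rewrite divr_gt0// => /(_ isT).
  rewrite divfK ?gt_eqF// => h.
  have c0 : 0 <= L ^+ 2 / N ^+ 2 by rewrite divr_ge0// sqr_ge0.
  have := ler_wpM2l c0 h; rewrite /t; congr (_ <= _); field; by rewrite !gt_eqF.
have := @strict_ineq_scalar t (M ^+ 2 * L / N ^+ 2) tgt0 t3 H1.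
rewrite ltr_pdivrMr ?exprn_gt0// => h.
rewrite -(ltr_pM2r L0); apply: lt_le_trans h _.
rewrite le_eqVlt; apply/orP; left; apply/eqP.
by rewrite -/t {1}/t; field; rewrite gt_eqF.
Qed.

End inequality.

(** * Test functions close to the extremal of the energy estimate *)

Section test_in_H10.
Context {R : realType} (L : R) (L0 : 0 < L).
Notation mu := (@lebesgue_measure R).

Lemma Rintegral_oo_cc (f : R -> R) : continuous f ->
  \int[mu]_(x in `]0, L[) f x = \int[mu]_(x in `[0, L]) f x.
Proof.
move=> cf; have mf : measurable_fun `]0%R, L[ f.
  by apply: measurable_funTS; exact: continuous_measurable_fun.
rewrite /Rintegral -(@integral_itv_bndoo _ _ _ _ true false)//=.
exact/measurable_EFinP.
Qed.

Lemma test_function_in_H10 (phi : R -> R) : test_function L phi ->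
  in_H10 L phi phi^`()%classic.
Proof.
move=> tphi; have [phiL dphiL] := test_function_in_L2 tphi.
have [dphi sphi sdphi] := test_function_smooth tphi.
split => //.
- move=> psi tpsi; have [dpsi spsi sdpsi] := test_function_smooth tpsi.
  rewrite !Rintegral_oo_cc; [|apply: smooth_continuous; auto with smooth..].
  apply/eqP; rewrite -addr_eq0 -RintegralD//; last first.
  - by apply: continuous_integrable; apply: smooth_continuous; auto with smooth.
  - by apply: continuous_integrable; apply: smooth_continuous; auto with smooth.
  have dM x : is_derive x (1 : R) (fun x => phi x * psi x)
      (phi x * psi^`()%classic x + phi^`()%classic x * psi x).
    by apply: is_derive_eq (is_derive_fmul (dphi x) (dpsi x)) _; rewrite (mulrC (psi x)).
  rewrite (Rintegral_derive (ltW L0) dM).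
    by rewrite (test_function_out (x := L) tphi) ?(test_function_out (x := 0) tphi)
      ?ltxx ?andbF// !mul0r subrr.
  by apply: smooth_continuous; auto with smooth.
- move=> e e0; exists phi => //.
  have n0 (v : R -> R) : norm2 L (v \- v) = 0.
    rewrite /norm2 (_ : EFin \o _ = cst 0%E) ?Lnorm0//.
    by apply/funext => x; rewrite /= patchE; case: ifP => _ //=; rewrite subrr.
  by rewrite !n0 expr0n addr0 sqrtr0.
Qed.

(** A null set contains no interval, so that for a continuous function an
    almost everywhere bound holds everywhere. *)
Lemma norm_oo_ge (u : R -> R) (M x : R) : continuous u -> 0 < x < L ->
  (norm_oo L u <= M%:E)%E -> `|u x| <= M.
Proof.
move=> cu xL /norm_oo_leP [N [mN N0 sub]]; rewrite leNgt; apply/negP => Mx.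
have : \forall y \near x, M < `|u y|.
  have cn : continuous (fun y => `|u y|).
    by move=> y; apply: (@continuous_comp _ _ _ u Num.norm); [exact: cu|exact: norm_continuous].
  exact: (cvgr_gt _ (cn x)).
have : \forall y \near x, y \in `]0, L[.
  by apply: near_in_itvoo; rewrite in_itv.
move=> H1 H2; have := filterI H1 H2; rewrite -nbhs_ballE => -[r /= r0 ball_sub].
have : (mu `](x - r)%R, (x + r)%R[ <= mu N)%E.
  apply: le_measure; rewrite ?inE//=.
  move=> y /=; rewrite in_itv/= => yr; apply: sub => /=.
  have [yL My] : (y \in `]0, L[) /\ (M < `|u y|).
    by apply: ball_sub; rewrite -ball_normE/= ltr_distlC.
  by rewrite patchE mem_set// leNgt My.
rewrite N0 lebesgue_measure_itv/= lte_fin ifT; last lra.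
by rewrite lee_fin; lra.
Unshelve. all: by end_near. Qed.

End test_in_H10.

Section tent_integrals.
Context {R : realType} (L l : R) (L0 : 0 < L) (l0 : 0 < l).
Notation mu := (@lebesgue_measure R).
Let h := L / 2.

Lemma sinh_tent_half (x : R) (c : R) : c = 0 /\ x <= h \/ c = L /\ h <= x ->
  sinh (l * (h - `|x - h|)) ^+ 2 = sinh (l * (x - c)) ^+ 2.
Proof.
move=> [[-> xh]|[-> hx]].
  by rewrite ler0_norm ?subr_le0// !subr0; congr (sinh (l * _) ^+ 2); lra.
rewrite ger0_norm ?subr_ge0//.
rewrite (_ : l * _ = - (l * (x - L))); first by rewrite sinhN sqrrN.
by rewrite /h; lra.
Qed.

Let P (a b c y : R) : R :=
  a * ((sinh (l * (y - c)) * cosh (l * (y - c)) / l - (y - c)) / 2) + b * (y - c).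

Let p (a b c y : R) : R := a * sinh (l * (y - c)) ^+ 2 + b.

Let dP (a b c y : R) : is_derive y (1 : R) (P a b c) (p a b c y).
Proof.
have ln0 : l != 0 by rewrite gt_eqF.
have D := is_derive_fadd (is_derive_fmul (is_derive_cst a y 1)
  (is_derive_sinh_sqr_primitive c y ln0)) (is_derive_affine b c y).
by apply: is_derive_eq D _; rewrite /p /=; ring.
Qed.

Let cp (a b c : R) : continuous (p a b c).
Proof.
apply: smooth_continuous; have s := smooth_affine 1 l c.
have := smooth_comp (smooth_sinh 1) s; rewrite /p; auto with smooth.
Qed.

Let PE (a b : R) : P a b 0 h - P a b 0 0 + (P a b L L - P a b L h) =
  a * (sinh (l * h) * cosh (l * h) / l - h) + b * L.
Proof.
have hL : l * (h - L) = - (l * h) by rewrite /h; lra.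
by rewrite /P !subrr !subr0 !mulr0 sinh0 hL sinhN coshN /h; field; rewrite gt_eqF.
Qed.

(** All the norms below are integrals of some q that compares with
    a sinh^2 + b at the exact tent; the integral of sinh^2 over the whole
    interval is sinh (l h) cosh (l h) / l - h. *)
Lemma Rintegral_le_tent (q : R -> R) (a b : R) : continuous q ->
  (forall x, 0 <= x <= L -> q x <= a * sinh (l * (h - `|x - h|)) ^+ 2 + b) ->
  \int[mu]_(x in `[0, L]) q x <=
    a * (sinh (l * h) * cosh (l * h) / l - h) + b * L.
Proof.
move=> cq qle; have h0 : 0 <= h by rewrite divr_ge0// ltW.
have hL : h <= L by move: (L0); rewrite /h; lra.
rewrite (Rintegral_split h0 hL cq) -PE; apply: lerD.
  apply: (ge_Rintegral_derive h0 (dP a b 0) (@cp a b 0) cq) => x /andP[x0 xh].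
  rewrite /p -sinh_tent_half; last by left.
  by apply: qle; rewrite x0 (le_trans xh).
apply: (ge_Rintegral_derive hL (dP a b L) (@cp a b L) cq) => x /andP[hx xL].
rewrite /p -sinh_tent_half; last by right.
by apply: qle; rewrite xL (le_trans h0).
Qed.

Lemma Rintegral_ge_tent (q : R -> R) (a b : R) : continuous q ->
  (forall x, 0 <= x <= L -> a * sinh (l * (h - `|x - h|)) ^+ 2 + b <= q x) ->
  a * (sinh (l * h) * cosh (l * h) / l - h) + b * L <=
  \int[mu]_(x in `[0, L]) q x.
Proof.
move=> cq qge; have h0 : 0 <= h by rewrite divr_ge0// ltW.
have hL : h <= L by move: (L0); rewrite /h; lra.
rewrite (Rintegral_split h0 hL cq) -PE; apply: lerD.
  apply: (le_Rintegral_derive h0 (dP a b 0) (@cp a b 0) cq) => x /andP[x0 xh].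
  rewrite /p -sinh_tent_half; last by left.
  by apply: qge; rewrite x0 (le_trans xh).
apply: (le_Rintegral_derive hL (dP a b L) (@cp a b L) cq) => x /andP[hx xL].
rewrite /p -sinh_tent_half; last by right.
by apply: qge; rewrite xL (le_trans h0).
Qed.

Variables (e : R) (e0 : 0 < e).

(** The maximiser sinh (l min (x, L - x)) of the energy estimate, smoothed by
    composition: 0 <= [softtent] <= tent and |[dsofttent]| <= 1 give the upper
    bounds on both norms without any error term. *)
Definition trial (x : R) : R := sinh (l * softtent e h x).

Let dtrial (x : R) : R := cosh (l * softtent e h x) * (l * dsofttent e h x).

Let is_derive_trial (x : R) : is_derive x (1 : R) trial (dtrial x).
Proof.
have D := is_derive_fmul (is_derive_cst l x 1) (is_derive_softtent e0 h x).
have D2 := @is_derive_fcomp _ sinh (fun y => l * softtent e h y) x _ _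
  (is_derive_sinh _) D.
by apply: is_derive_eq D2 _; rewrite /dtrial /=; ring.
Qed.

Let trial_derive : trial^`()%classic = dtrial.
Proof.
by apply/funext => x; rewrite derive1E (@derive_val _ _ _ _ _ _ _ (is_derive_trial x)).
Qed.

Lemma test_function_trial : test_function L trial.
Proof.
have sub : closure [set x | trial x != 0] `<=` `[e, L - e].
  rewrite [X in _ `<=` X](closure_id _).1; last exact: interval_closed.
  apply: closure_subset => x /=; rewrite in_itv/=; apply: contraNT => xe.
  rewrite /trial softtent_eq0 ?mulr0 ?sinh0//.
  rewrite leNgt; apply: contra xe; rewrite ltr_norml /h => /andP[? ?]; lra.
split.
- apply: smooth_derivable => n; apply: (smooth_comp (smooth_sinh n)).
  by apply: smoothM; [exact: smooth_cst|exact: smooth_softtent].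
- apply: subclosed_compact sub; first exact: closed_closure.
  exact: segment_compact.
- apply: subset_trans sub _ => x /=; rewrite !in_itv/= => /andP[? ?].
  by move: (e0) => ?; apply/andP; split; lra.
Qed.

Let tent_ge0 x : 0 <= x <= L -> 0 <= h - `|x - h|.
Proof. by move=> xL; rewrite subr_ge0 ler_norml /h; lra. Qed.

Let softtent_tent x : 0 <= x <= L ->
  0 <= l * softtent e h x <= l * (h - `|x - h|).
Proof.
move=> xL; rewrite mulr_ge0 ?softtent_ge0 ?(ltW l0)//= ler_pM2l//.
exact/softtent_le/tent_ge0.
Qed.

Lemma sqr_norm2_trial_le :
  norm2 L trial ^+ 2 <= sinh (l * h) * cosh (l * h) / l - h.
Proof.
have [_ s _] := test_function_smooth test_function_trial.
rewrite sqr_norm2_continuous; last exact: smooth_continuous.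
rewrite -[leRHS]addr0 -[X in _ <= X + _]mul1r -[X in _ <= _ + X](mul0r L).
apply: Rintegral_le_tent; first by apply: smooth_continuous; auto with smooth.
move=> x /softtent_tent /andP[m0 m1]; rewrite mul1r addr0.
by rewrite ler_sqr ?nnegrE ?sinh_ge0 ?sinh_le// (le_trans m0).
Qed.

(** From T^2 >= S^2 - 2 S (S - T), where T is the trial function, S the exact
    profile, and S - T <= 3 l e e^(l h). *)
Lemma sqr_norm2_trial_ge : sinh (l * h) * cosh (l * h) / l - h
  - 6 * l * e * expR (l * h) ^+ 2 * L <= norm2 L trial ^+ 2.
Proof.
have [_ s _] := test_function_smooth test_function_trial.
rewrite sqr_norm2_continuous; last exact: smooth_continuous.
rewrite [leLHS](_ : _ = 1 * (sinh (l * h) * cosh (l * h) / l - h)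
  + - (6 * l * e * expR (l * h) ^+ 2) * L); last by ring.
apply: Rintegral_ge_tent; first by apply: smooth_continuous; auto with smooth.
move=> x xL; have /andP[m0 m1] := softtent_tent xL; rewrite mul1r /trial.
set S := sinh (l * (h - _)); set T := sinh _.
have S0 : 0 <= S by rewrite sinh_ge0// mulr_ge0 ?tent_ge0// ltW.
have T0 : 0 <= T by exact: sinh_ge0.
have E0 := expR_gt0 (l * h).
have tl : l * (h - `|x - h|) <= l * h by rewrite ler_pM2l// gerBl.
have El : expR (l * (h - `|x - h|)) <= expR (l * h) by rewrite ler_expR.
have SE : S <= expR (l * h).
  by apply: le_trans El; apply: sinh_le_expR; exact: le_trans m1.
have ST : S - 3 * l * e * expR (l * h) <= T.
  apply: le_trans (sinh_lipschitz m0 m1); rewrite -/S lerD2l lerN2.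
  have le0 : 0 <= l * e by rewrite mulr_ge0// ltW.
  apply: (@le_trans _ _ (3 * l * e * expR (l * (h - `|x - h|)))).
    rewrite ler_wpM2r ?expR_ge0//.
    have := ler_wpM2l (ltW l0) (softtent_ge e0 h x); lra.
  by rewrite ler_wpM2l//; lra.
have le0 : 0 <= l * e by rewrite mulr_ge0// ltW.
have h1 := ler_wpM2l S0 ST.
have h2 : S * (l * e * expR (l * h)) <= expR (l * h) * (l * e * expR (l * h)).
  by rewrite ler_wpM2r// mulr_ge0// ltW.
have := sqr_ge0 (S - T); rewrite sqrrB; lra.
Qed.

Lemma sqr_norm2_dtrial_le : norm2 L trial^`()%classic ^+ 2 <=
  l ^+ 2 * (sinh (l * h) * cosh (l * h) / l + h).
Proof.
have [_ _ s] := test_function_smooth test_function_trial.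
rewrite sqr_norm2_continuous; last exact: smooth_continuous.
rewrite [leRHS](_ : _ = l ^+ 2 * (sinh (l * h) * cosh (l * h) / l - h) + l ^+ 2 * L).
  apply: Rintegral_le_tent; first by apply: smooth_continuous; auto with smooth.
  move=> x xL; have /andP[m0 m1] := softtent_tent xL.
  rewrite -[X in _ <= _ + X]mulr1 -mulrDr -sqr_cosh trial_derive -exprMn.
  rewrite -[leLHS]real_normK ?num_real// ler_sqr ?nnegrE//; last first.
    by rewrite mulr_ge0 ?(ltW l0)// ltW// cosh_gt0.
  rewrite /dtrial normrM (normrM l) (gtr0_norm l0) (gtr0_norm (cosh_gt0 _)) mulrCA ler_pM2l//.
  apply: le_trans (cosh_le m0 m1).
  by rewrite ler_piMr ?(ltW (cosh_gt0 _))// dsofttent_le1.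
by rewrite /h; field; rewrite gt_eqF.
Qed.

Lemma trial_mid : sinh (l * h) - 3 * l * e * expR (l * h) <= trial h.
Proof.
have hh : 0 <= h <= L by move: (L0) => ?; rewrite /h; apply/andP; split; lra.
have /andP[m0 m1] := softtent_tent hh.
apply: le_trans (_ : _ <= sinh (l * (h - `|h - h|)) - _) (sinh_lipschitz m0 m1).
have := softtent_ge e0 h h; rewrite subrr normr0 subr0 => hg.
rewrite lerD2l lerN2 ler_wpM2r ?expR_ge0//.
by have := ler_wpM2l (ltW l0) hg; lra.
Qed.

End tent_integrals.

(** * The trial functions almost attain the bound *)

Section scalar_asymptotics.
Context {R : realType}.
Implicit Types y t A M eta : R.

Lemma sinh_cosh_expR y :
  sinh y * cosh y = (expR (2 * y) - (expR (2 * y))^-1) / 4 /\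
  sinh y ^+ 2 = (expR (2 * y) + (expR (2 * y))^-1 - 2) / 4.
Proof.
have E0 := expR_gt0 y; have -> : expR (2 * y) = expR y ^+ 2.
  by rewrite -[2]/(2%:R) expRM_natl.
by rewrite /sinh /cosh expRN; split; field; rewrite gt_eqF.
Qed.

Lemma expR_double_ge y : 0 < y -> 4 / 15 * y ^+ 5 + 1 <= expR (2 * y).
Proof.
move=> y0; have := @expR_ge1Dxn R (2 * y) 4 (ltW (mulr_gt0 (ltr0n _ 2) y0)).
apply: le_trans; rewrite exprMn.
set f := (5 `!)%:R; have -> : f = 120 :> R by [].
by rewrite !exprS expr0; lra.
Qed.

Lemma sinh_cosh_ge y : 10 < y -> 3 * y ^+ 2 + 2 < sinh y * cosh y / y.
Proof.
move=> y10; have y0 : 0 < y by lra.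
have [-> _] := sinh_cosh_expR y.
have : (expR (2 * y))^-1 <= 1.
  by rewrite -expRN expR_le1 oppr_le0; lra.
have := expR_double_ge y0; set z := expR _ => zy u1.
rewrite ltr_pdivlMr//; apply: (@lt_le_trans _ _ (y ^+ 5 / 15)); last by lra.
rewrite (_ : y ^+ 5 = y ^+ 2 * y ^+ 2 * y); last by ring.
have y2 : 100 < y ^+ 2 by clear - y10 y0; nra.
rewrite mulrAC ltr_pM2r//; clear - y2; move: (y ^+ 2) y2 => w; nra.
Qed.

(** For a trial function, t = L |u'| / |u| and A = sinh y cosh y / y with
    y = l L / 2.  As A is exponentially large, t <= 2 y sqrt ((A + 1) / (A - 2))
    exceeds l L by very little. *)
Lemma le_near_double y t A : 0 < y -> 0 < t -> 3 * y ^+ 2 + 2 < A ->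
  t ^+ 2 * (A - 2) <= 4 * y ^+ 2 * (A + 1) -> t <= 2 * y + y^-1.
Proof.
move=> y0 t0 Abig t2; rewrite leNgt; apply/negP => tgt.
have iy0 : 0 < y^-1 by rewrite invr_gt0.
have t4 : 4 * y ^+ 2 + 4 <= t ^+ 2.
  apply: (@le_trans _ _ ((2 * y + y^-1) ^+ 2)).
    rewrite (_ : (2 * y + y^-1) ^+ 2 = 4 * y ^+ 2 + 4 + y^-1 ^+ 2).
      by rewrite lerDl sqr_ge0.
    by field; rewrite gt_eqF.
  by rewrite ler_sqr ?nnegrE ?(ltW tgt) ?(ltW t0)// addr_ge0 ?mulr_ge0// ltW.
have A2 : 0 <= A - 2.
  by have := sqr_ge0 y; clear - Abig; lra.
have := ler_wpM2r A2 t4; clear - t2 Abig; lra.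
Qed.

Lemma expRN_le_inv y : 0 < y -> expR (- y) <= y^-1.
Proof.
move=> y0; rewrite expRN lef_pV2 ?posrE ?expR_gt0//.
by have := expR_ge1Dx y; lra.
Qed.

(** sinh y cosh y - sinh^2 y = (1 - e^(-2 y)) / 2: the half is where the
    constant 2 of the theorem comes from. *)
Lemma sinh_cosh_sub_sqr_le y M : 10 < y -> 0 <= M ->
  sinh y - (expR (2 * y))^-1 <= M ->
  sinh y * cosh y - M ^+ 2 <= 1 / 2 + y^-1.
Proof.
move=> y10 M0 Mge; have y0 : 0 < y by lra.
have [B2 s2] := sinh_cosh_expR y; rewrite B2.
have iy := expRN_le_inv y0.
have iy1 : y^-1 <= 10^-1 by rewrite lef_pV2 ?posrE// ltW.
move: Mge s2; set s := sinh y; set z := expR (2 * y) => Mge s2.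
have u0 : 0 < z^-1 by rewrite invr_gt0 expR_gt0.
have uE : z^-1 * expR y = expR (- y) by rewrite /z -expRN -expRD; congr expR; ring.
have sE : s <= expR y / 2.
  by rewrite /s /sinh; have := expR_gt0 (- y); clear; lra.
have us : z^-1 * s <= y^-1 / 2.
  have := ler_wpM2l (ltW u0) sE; rewrite [leRHS]mulrA uE.
  by move: iy; clear; lra.
have u1 : z^-1 <= 1 by rewrite /z -expRN expR_le1 oppr_le0; lra.
have su : 0 <= s - z^-1.
  have E1 : 1 + y <= expR y by exact: expR_ge1Dx.
  by move: iy iy1 u1; rewrite /s /sinh; clear - y10 E1; lra.
have : (s - z^-1) ^+ 2 <= M ^+ 2 by rewrite ler_sqr ?nnegrE.
rewrite sqrrB s2; have := sqr_ge0 z^-1.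
by move: us (ltW u0); clear; lra.
Qed.

(** Since sinh y cosh y is about e^(2 y) / 4, the product with 2 e^-t tends to
    1 / 2 when t is close to 2 y; eta absorbs the errors of order 1 / y. *)
Lemma sinh_cosh_expRN_ge y t eta : 0 < eta -> 10 + 8 / eta <= y ->
  t <= 2 * y + y^-1 ->
  1 / 2 + y^-1 <= sinh y * cosh y * ((2 + eta) * expR (- t)).
Proof.
move=> eta0 yeta ty; have ieta : 0 < 8 / eta by rewrite divr_gt0.
have y10 : 10 < y by clear - ieta yeta; lra.
have y0 : 0 < y by clear - y10; lra.
have [-> _] := sinh_cosh_expR y.
set z := expR (2 * y); have z0 : 0 < z by exact: expR_gt0.
set u := z^-1; set iy := y^-1.
have u0 : 0 < u by rewrite invr_gt0.
have iy0 : 0 < iy by rewrite invr_gt0.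
have yiy : y * iy = 1 by rewrite mulfV// gt_eqF.
have iy1 : iy <= 10^-1 by rewrite lef_pV2 ?posrE// ltW.
have uz : u * z = 1 by rewrite mulVf// gt_eqF.
have uiy : u <= iy.
  have y20 : 0 < 2 * y by rewrite mulr_gt0.
  rewrite /u /z -expRN; apply: le_trans (expRN_le_inv y20) _.
  by rewrite lef_pV2 ?posrE// ler_peMl ?(ltW y0)// ler1n.
have et : u * (1 - iy) <= expR (- t).
  apply: (@le_trans _ _ (expR (- (2 * y) + - iy))); last first.
    by rewrite ler_expR; clear - ty; rewrite /iy; lra.
  by rewrite expRD expRN -/z -/u ler_pM2l// expR_ge1Dx.
have ey : iy * (10 * eta + 8) <= eta.
  have h : 10 * eta + 8 <= eta * y.
    have := ler_wpM2l (ltW eta0) yeta; rewrite mulrDr mulrCA mulfV ?gt_eqF//.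
    by clear; lra.
  have := ler_wpM2l (ltW iy0) h.
  by rewrite (_ : iy * (eta * y) = eta * (y * iy)); [rewrite yiy mulr1|ring].
have zu0 : 0 <= (z - u) / 4.
  by rewrite divr_ge0// subr_ge0 /u /z -expRN ler_expR; clear - y0; lra.
have e2 : 0 <= 2 + eta by rewrite addr_ge0// ltW.
apply: (@le_trans _ _ ((z - u) / 4 * ((2 + eta) * (u * (1 - iy))))); last first.
  by rewrite ler_wpM2l// ler_wpM2l.
have -> : (z - u) / 4 * ((2 + eta) * (u * (1 - iy))) =
    (2 + eta) / 4 * ((1 - u ^+ 2) * (1 - iy)).
  by rewrite (_ : 1 - u ^+ 2 = u * z - u ^+ 2); [ring|rewrite uz].
apply: (@le_trans _ _ ((2 + eta) / 4 * (1 - 2 * iy))).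
  by move: ey (mulr_gt0 eta0 iy0); clear; lra.
rewrite ler_wpM2l ?divr_ge0//.
have u2 : u ^+ 2 <= iy.
  rewrite expr2; apply: (le_trans _ uiy); rewrite ler_piMr ?(ltW u0)//.
  by apply: (le_trans uiy); apply: (le_trans iy1); clear; lra.
have : 0 <= iy * u ^+ 2 by rewrite mulr_ge0 ?sqr_ge0// ltW.
by move: u2; clear; lra.
Qed.

(** For h = L / 2, l = y / h and N, D, M the norms of a trial function, of its
    derivative and its sup: N D is at most sinh y cosh y, and M is almost
    sinh y at least. *)
Lemma near_extremal_scalar (h y eta N D M : R) :
  let z := expR (2 * y) in let t := 2 * h * D / N in
  0 < h -> 0 < eta -> 10 + 8 / eta <= y -> 0 < N -> 0 < D -> 0 <= M ->
  sinh y - z^-1 <= M ->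
  N ^+ 2 <= h * (sinh y * cosh y / y - 1) ->
  h * (sinh y * cosh y / y - 1 - 4 * z^-1 * expR y) <= N ^+ 2 ->
  D ^+ 2 <= y ^+ 2 / h * (sinh y * cosh y / y + 1) ->
  M ^+ 2 <= N * D ->
  y <= t /\ N * D * (1 - (2 + eta) * expR (- t)) <= M ^+ 2.
Proof.
move=> z t h0 eta0 yeta N0 D0 M0 Mge Nle Nge Dle MND.
have ieta : 0 < 8 / eta by rewrite divr_gt0.
have y10 : 10 < y by clear - ieta yeta; lra.
have y0 : 0 < y by clear - y10; lra.
have iy1 : y^-1 <= 10^-1 by rewrite lef_pV2 ?posrE// ltW.
have zE : z^-1 * expR y <= y^-1.
  apply: le_trans (expRN_le_inv y0); rewrite le_eqVlt; apply/orP; left; apply/eqP.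
  by rewrite /z -expRN -expRD; congr expR; ring.
have MB := sinh_cosh_sub_sqr_le y10 M0 Mge.
have Abig := sinh_cosh_ge y10.
have key t' := @sinh_cosh_expRN_ge y t' eta eta0 yeta.
move: Nle Nge Dle MB Abig key; set B := sinh y * cosh y.
set A := B / y => Nle Nge Dle MB Abig key.
have AB : A * y = B by rewrite /A divfK// gt_eqF.
have A2 : 302 < A.
  by apply: le_lt_trans Abig; clear - y10; nra.
clearbody A B; clear Mge.
have {}Nge : h * (A - 2) <= N ^+ 2.
  apply: le_trans Nge; rewrite ler_pM2l// -mulrA; clear - zE iy1; lra.
have tN : t * N = 2 * h * D by rewrite /t divfK// gt_eqF.
have t0 : 0 < t by rewrite divr_gt0// !mulr_gt0.
clearbody t z.
have {}key : 1 / 2 + y^-1 <= B * ((2 + eta) * expR (- t)).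
  apply/key/(le_near_double y0 t0 Abig).
  rewrite -(ler_pM2l h0); apply: (@le_trans _ _ (t ^+ 2 * N ^+ 2)).
    by rewrite mulrCA ler_pM2l ?exprn_gt0.
  rewrite -exprMn tN; have h2 : 0 <= 4 * h ^+ 2 by rewrite mulr_ge0 ?sqr_ge0.
  have := ler_wpM2l h2 Dle; congr (_ <= _); first by ring.
  by field; rewrite gt_eqF.
have A0 : 0 < A by clear - A2; lra.
have BA : 10 * A <= B by rewrite -AB mulrC ler_pM2l// ltW.
split.
  rewrite -(ler_pM2l A0) AB; apply: (@le_trans _ _ (2 * M ^+ 2)).
    by clear - MB BA A2 iy1; lra.
  rewrite -(ler_pM2l h0) mulrCA; apply: (@le_trans _ _ (t * N ^+ 2)).
    rewrite (expr2 N) (mulrA t) tN; have := ler_wpM2l (ltW h0) MND; clear; lra.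
  have := ler_wpM2l (ltW t0) Nle; have := mulr_gt0 h0 t0; clear; lra.
have NDB : N * D <= B.
  have BB : (N * D) ^+ 2 <= B ^+ 2.
    rewrite exprMn; apply: (@le_trans _ _ (h * (A - 1) * (y ^+ 2 / h * (A + 1)))).
      by apply: ler_pM => //; exact: sqr_ge0.
    rewrite -AB (_ : _ * _ = y ^+ 2 * (A ^+ 2 - 1)); last by field; rewrite gt_eqF.
    have := sqr_ge0 y; clear; lra.
  move: BB; rewrite ler_sqr ?nnegrE ?mulr_ge0 ?(ltW N0) ?(ltW D0)//.
  by apply: le_trans BA; rewrite mulr_ge0// ltW.
have [r0|r0] := leP (1 - (2 + eta) * expR (- t)) 0.
  by apply: le_trans (sqr_ge0 M); rewrite pmulr_rle0// mulr_gt0.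
by apply: le_trans (ler_wpM2r (ltW r0) NDB) _; clear - MB key; lra.
Qed.

End scalar_asymptotics.

Lemma nonzero_at {R : realType} (L : R) (u : R -> R) (x : R) : continuous u ->
  0 < x < L -> u x != 0 -> nonzero L u.
Proof.
move=> cu xL ux [A [mA A0 sub]].
have : `|u x| <= 0.
  apply: (norm_oo_ge cu xL); apply/norm_oo_leP; exists A; split => //.
  apply: subset_trans sub => y /=; apply: contra_not => h; rewrite patchE.
  by case: ifP => [/set_mem yL|_]; rewrite ?h// normr0.
by rewrite normr_le0 (negbTE ux).
Qed.

(** These functions rule out every constant larger than 2 + eta in the place
    of 2; that t = L |u'| / |u| can be prescribed to be large serves for the
    other coefficient. *)
Lemma near_extremal {R : realType} (L y eta : R) :
  0 < L -> 0 < eta -> 10 + 8 / eta <= y ->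
  exists u du : R -> R, [/\ in_H10 L u du, nonzero L u,
    y <= L * norm2 L du / norm2 L u & exists2 M : R, norm_oo L u = M%:E &
    norm2 L u * norm2 L du *
      (1 - (2 + eta) * expR (- (L * norm2 L du / norm2 L u))) <= M ^+ 2].
Proof.
move=> L0 eta0 yeta.
have y0 : 0 < y by have : 0 < 8 / eta by [rewrite divr_gt0]; lra.
pose h := L / 2; have h0 : 0 < h by rewrite divr_gt0.
have hn0 : h != 0 by rewrite gt_eqF.
pose l := y / h; have l0 : 0 < l by rewrite divr_gt0.
have lh : l * h = y by rewrite divfK.
pose z := expR (2 * y).
(* The width of the smoothing: it makes the error of the trial function e^(-2 y). *)
pose e := z^-1 * expR (- y) / (3 * l).
have e0 : 0 < e by rewrite divr_gt0 ?mulr_gt0 ?invr_gt0 ?expR_gt0.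
have lee : 3 * l * e * expR y = z^-1.
  rewrite /e mulrCA mulfV ?mulr1; last by rewrite mulf_neq0 ?gt_eqF.
  by rewrite -mulrA -expRD addNr expR0 mulr1.
have tb := test_function_trial L l e0.
have Hb := test_function_in_H10 L0 tb.
have [_ sb _] := test_function_smooth tb.
have cb := smooth_continuous (sb 1%N).
have hL : 0 < h < L by move: L0 => ?; rewrite /h; apply/andP; split; lra.
have mid := trial_mid L0 l0 e0; rewrite -/h lh lee in mid.
have mid0 : 0 < trial L l e h.
  apply: lt_le_trans mid; rewrite subr_gt0.
  have E1 : 1 + y <= expR y by exact: expR_ge1Dx.
  have z1 : z^-1 <= 1 by rewrite -expRN expR_le1 oppr_le0 mulr_ge0 ?(ltW y0).
  have yeta10 : 10 < y by have : 0 < 8 / eta by [rewrite divr_gt0]; lra.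
  have : expR (- y) <= 1 by rewrite expR_le1 oppr_le0 ltW.
  rewrite /sinh; lra.
have nz : nonzero L (trial L l e) by apply: (nonzero_at cb hL); rewrite gt_eqF.
exists (trial L l e), (trial L l e)^`()%classic.
have [N0 D0 [M ME Mlt]] := in_H10_strict L0 Hb nz.
have hM : trial L l e h <= M.
  by apply: le_trans (ler_norm _) _; apply: (norm_oo_ge cb hL); rewrite ME.
have Nle := sqr_norm2_trial_le L0 l0 e0; rewrite -/h lh in Nle.
have Nge := sqr_norm2_trial_ge L0 l0 e0; rewrite -/h lh in Nge.
have Dle := sqr_norm2_dtrial_le L0 l0 e0; rewrite -/h lh in Dle.
move: N0 D0 Mlt Nle Nge Dle.
set N := norm2 L (trial _ _ _); set D := norm2 L _^`()%classic.
move=> N0 D0 Mlt Nle Nge Dle.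
have MND : M ^+ 2 <= N * D.
  apply: le_trans (ltW Mlt) (ler_piMr _ _); first by rewrite ltW// mulr_gt0.
  by rewrite gerBl mulr_ge0 ?expR_ge0.
have L2 : L = 2 * h by rewrite /h; field.
have M0 : 0 <= M by apply: le_trans hM; exact: ltW.
have [|||||yt ext] := @near_extremal_scalar R h y eta N D M h0 eta0 yeta N0 D0 M0.
- exact: le_trans hM.
- apply: le_trans Nle _; rewrite le_eqVlt; apply/orP; left; apply/eqP.
  by rewrite /l; field; rewrite hn0 gt_eqF.
- apply: le_trans Nge; rewrite le_eqVlt; apply/orP; left; apply/eqP.
  rewrite (_ : 6 * l * e * expR y ^+ 2 * L = 2 * (3 * l * e * expR y) * expR y * L).
    by rewrite lee -/z {1}/l L2; field; rewrite hn0 !gt_eqF ?expR_gt0.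
  by ring.
- apply: le_trans Dle _; rewrite le_eqVlt; apply/orP; left; apply/eqP.
  by rewrite /l; field; rewrite hn0 gt_eqF.
- exact: MND.
rewrite -L2 in yt ext.
by split; [exact: Hb|exact: nz|exact: yt|exists M; [exact: ME|exact: ext]].
Qed.

(** * The sharp inequality *)

Unset Implicit Arguments.

Theorem theorem3p19 (R : realType) (L : R) (hL : 0 < L) :
  [/\ (* the inequality *)
      forall u du : R -> R, in_H10 L u du -> nonzero L u ->
        (norm_oo L u ^+ 2 <=
         (norm2 L u * norm2 L du *
           (1 - 2 * expR (- (L * norm2 L du / norm2 L u))))%:E)%E,
      (* the coefficient 1 of the first term is sharp *)
      forall a b : R, a < 1 ->
        ~ (forall u du : R -> R, in_H10 L u du -> nonzero L u ->
            (norm_oo L u ^+ 2 <=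
             (norm2 L u * norm2 L du *
               (a + b * expR (- (L * norm2 L du / norm2 L u))))%:E)%E),
      (* with the coefficient 1, the number 2 is sharp *)
      forall c : R, 2 < c ->
        ~ (forall u du : R -> R, in_H10 L u du -> nonzero L u ->
            (norm_oo L u ^+ 2 <=
             (norm2 L u * norm2 L du *
               (1 - c * expR (- (L * norm2 L du / norm2 L u))))%:E)%E) &
      (* there is no extremal function *)
      ~ (exists u du : R -> R, [/\ in_H10 L u du, nonzero L u &
            (norm_oo L u ^+ 2 =
             (norm2 L u * norm2 L du *
               (1 - 2 * expR (- (L * norm2 L du / norm2 L u))))%:E)%E])].
Proof.
split.
- move=> u du Hu nz; have [_ _ [M -> Mlt]] := in_H10_strict hL Hu nz.
  by rewrite -EFin_expe lee_fin ltW.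
- move=> a b a1 H.
  (* Both bounds on the ratio force 1 - a <= (3 + |b|) e^-t, which fails once
     t >= y; the 18 also meets the requirement of near_extremal for eta = 1. *)
  pose y := 18 + 2 * (3 + `|b|) / (1 - a).
  have k0 : 0 < (3 + `|b|) / (1 - a).
    by rewrite divr_gt0 ?subr_gt0// ltr_wpDr.
  have y18 : 10 + 8 / 1 <= y by move: k0; rewrite /y -mulrA; lra.
  have [u [du [Hu nz yt [M ME ext]]]] := near_extremal hL ltr01 y18.
  have [N0 D0 _] := in_H10_strict hL Hu nz.
  have := H u du Hu nz; rewrite ME -EFin_expe lee_fin => /(le_trans ext).
  rewrite ler_pM2l ?mulr_gt0//.
  set t := _ / _ in yt *; set E := expR (- t) => h.
  have y0 : 0 < y by apply: lt_le_trans y18; rewrite addr_gt0// divr_gt0.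
  have E0 : 0 < E by exact: expR_gt0.
  have Ey : E * y <= 1.
    rewrite -ler_pdivlMr// mul1r; apply: le_trans (expRN_le_inv y0).
    by rewrite ler_expR lerN2.
  have h2 : 1 - a <= (3 + `|b|) * E.
    have : b * E <= `|b| * E by rewrite ler_wpM2r ?ler_norm// ltW.
    by move: h; clear; lra.
  have a0 : 0 < 1 - a by rewrite subr_gt0.
  have h3 : (3 + `|b|) * E * 2 < 1 - a + (1 - a).
    have -> : (3 + `|b|) * E * 2 = (1 - a) * (E * (y - 18)).
      by rewrite /y; field; rewrite gt_eqF.
    apply: (@le_lt_trans _ _ ((1 - a) * 1)); last by rewrite mulr1 ltrDl.
    rewrite ler_pM2l// mulrBr; move: Ey (ltW E0); clear; lra.
  by move: h2 h3; clear; lra.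
- move=> c c2 H; have eta0 : 0 < (c - 2) / 2 by rewrite divr_gt0// subr_gt0.
  have [u [du [Hu nz _ [M ME ext]]]] := near_extremal hL eta0 (lexx _).
  have [N0 D0 _] := in_H10_strict hL Hu nz.
  have := H u du Hu nz; rewrite ME -EFin_expe lee_fin => /(le_trans ext).
  rewrite ler_pM2l ?mulr_gt0// lerD2l lerN2 ler_pM2r ?expR_gt0//.
  by move: c2; clear; lra.
- move=> [u [du [Hu nz]]]; have [_ _ [M -> Mlt]] := in_H10_strict hL Hu nz.
  by rewrite -EFin_expe => -[ME]; move: Mlt; rewrite ME ltxx.
Qed.
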